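(* Let $n$ be a nonnegative integer and $m$ a positive integer. The number of rhombus tilings of the hexagon $H(2n+1,2m-1)$ with side lengths $2n+1,2m-1,2n+1,2n+1,2m-1,2n+1$ which contain the rhombus above and next to the center of the hexagon (that is, the axis rhombus $\rho_l$ with $l=n+m$) equals \begin{multline*} \frac{(n+1) m \binom{2n}{n} \binom{2n+1}{n} \binom{2m-1}{m}}{\binom{4n+2m}{2n+m}} \Biggl(\frac{1}{(n+m)^2}+\frac{4n}{(n+1)(2n-1)(n+m-1)(n+m+1)}\\ \times\sum_{h=0}^{n-1}\frac{(2)_h\,(1-n)_h\,(\frac32+n)_h\,(1-n-m)_h\,(1+n+m)_h}{(1)_h\,(2+n)_h\,(\frac32-n)_h\,(2+n+m)_h\,(2-n-m)_h}\Biggr) \prod_{i=1}^{2n+1}\prod_{j=1}^{2m-1}\prod_{k=1}^{2n+1}\frac{i+j+k-1}{i+j+k-2}. \end{multline*}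
   Context: Shifted factorial: $(a)_0:=1$ and $(a)_k:=a(a+1)\cdots(a+k-1)$ for $k\ge1$. Singular expressions are to be read as the appropriate limit; here this only means that for $n=0$ the sum is empty and the second term in the large parentheses is $0$ (also when $m=1$). Hexagon: $H(N,M)$ is the hexagon with all angles $120^\circ$ and side lengths, in cyclic order, $N,M,N,N,M,N$, placed with vertices $(0,0)$, $(\pm\frac{\sqrt3}{2}N,\frac N2)$, $(\pm\frac{\sqrt3}{2}N,\frac N2+M)$, $(0,N+M)$ (the sides of length $M$ are vertical). It is subdivided into unit equilateral triangles by the triangular lattice generated by $(0,1)$ and $(\frac{\sqrt3}2,\frac12)$. A rhombus is the union of two unit lattice triangles sharing an edge (side lengths 1, angles $60^\circ$ and $120^\circ$); a rhombus tiling of $H(N,M)$ is a covering of $H(N,M)$ by such rhombi without overlaps. Axis rhombi: for $0\le l\le N+M-1$, $\rho_l$ is the rhombus with vertices $(0,l)$, $(0,l+1)$, $(\pm\frac{\sqrt3}{2},l+\frac12)$; these are the rhombi symmetric about the vertical symmetry axis (of length $N+M$). The center of the hexagon is $(0,\frac{N+M}2)$. *)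

(* Defs.v *)
From mathcomp Require Import all_boot all_order all_algebra.

Set Implicit Arguments.
Unset Strict Implicit.
Unset Printing Implicit Defensive.

Import Order.TTheory GRing.Theory Num.Theory.

(* The pair (i, j) stands for the lattice point i u + j v of the plane, where
   u = (sqrt 3 / 2, 1 / 2) and v = (- sqrt 3 / 2, 1 / 2); in Cartesian
   coordinates it is (sqrt 3 / 2 * (i - j), (i + j) / 2).  As (0, 1) = u + v,
   this is the triangular lattice generated by (0, 1) and u.  Only the cone
   0 <= i, j is needed, since it contains the hexagon H(N, M). *)
Definition point : Type := (nat * nat)%type.

(* H(N, M) is the convex hull of its vertices (0, 0), (N, 0), (0, N),
   (N + M, M), (M, N + M), (N + M, N + M).  The two sides at (0, 0) are the
   implicit 0 <= i and 0 <= j. *)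
Definition in_hexagon (N M : nat) (p : point) : bool :=
  [&& p.1 <= N + M, p.2 <= N + M, p.1 <= p.2 + N & p.2 <= p.1 + N].

(* The vertical segment from (i, j) to (i+1, j+1) is an edge of two unit lattice
   triangles: (i, j, true) lies to its right and (i, j, false) to its left.
   The bound on i and j loses no triangle of H(N, M). *)
Definition triangle (N M : nat) : finType :=
  ('I_(N + M) * 'I_(N + M) * bool)%type.

Definition vertices (N M : nat) (t : triangle N M) : seq point :=
  let: (i, j, is_right) := t in
  [:: (i : nat, j : nat);
      (if is_right then (i.+1, j : nat) else (i : nat, j.+1));
      (i.+1, j.+1)].

(* By convexity, a triangle lies in the hexagon iff its vertices do. *)
Definition hexagon (N M : nat) : {set triangle N M} :=
  [set t | all (in_hexagon N M) (vertices t)].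

Definition share_edge (N M : nat) (s t : triangle N M) : bool :=
  count (mem (vertices s)) (vertices t) == 2.

(* A union of unit triangles is represented by the set of these triangles. *)
Definition is_rhombus (N M : nat) (B : {set triangle N M}) : bool :=
  [exists s, exists t, share_edge s t && (B == [set s; t])].

Definition rhombus_tilings (N M : nat) : {set {set {set triangle N M}}} :=
  [set T | partition T (hexagon N M) & [forall B in T, is_rhombus B]].

(* The rhombus with Cartesian vertices (0, l), (0, l + 1),
   (sqrt 3 / 2, l + 1 / 2) and (- sqrt 3 / 2, l + 1 / 2). *)
Definition axis_rhombus (N M l : nat) : {set triangle N M} :=
  [set t | all (mem [:: (l, l); (l.+1, l.+1); (l.+1, l); (l, l.+1)])
               (vertices t)].

Local Open Scope ring_scope.

Definition shifted_factorial (a : rat) (k : nat) : rat :=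
  \prod_(0 <= i < k) (a + i%:R).

(* Main.v *)
(** Cut the hexagon along its vertical axis: a tiling consists of a set Z of N
    axis rhombi and of tilings of the two mirror-image halves with the triangles
    of Z removed.  Reading the columns of a half from the outside inwards, the
    positions of the rhombi crossing them form interlacing sequences, whence
    det (binomial (z_i, j)) tilings of the half.  By the Cauchy-Binet formula,
    the sum of the squares of these determinants over the sets Z is a Gram
    determinant for the uniform measure on {0, ..., N + M - 1}, and leaving out
    the point l is a rank one perturbation of it.  In the basis of the discrete
    Chebyshev polynomials p_k, of squared norms h_k, the number of tilings
    containing the rhombus rho_l is thus the total number of tilings times
    sum_(k < N) p_k(l)^2 / h_k.  For N + M = 2 s and l = s, the three-term
    recurrence of the p_k is solved by products, and the sum over k is matched
    with the hypergeometric sum by induction on n, the difference of two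
    consecutive hypergeometric sums being telescoping in h. *)

Require Import Defs.
From mathcomp Require Import all_boot all_order all_algebra.
From mathcomp Require Import fingroup perm zify ring lra.

Set Implicit Arguments.
Unset Strict Implicit.
Unset Printing Implicit Defensive.

Import Order.TTheory GRing.Theory Num.Theory.

(** * Perfect matchings *)

(** Tilings are treated as perfect matchings of the adjacency graph of the unit triangles: removing
    a matched pair leaves a region that is no longer a hexagon, so a recursion has to range over
    arbitrary regions. Interlacing comes from peeling off one vertical strip at a time. The
    triangles of a strip form a path, and from its lower end upwards every pairing is forced, except
    for the choice of the level at which a rhombus crosses into the next strip. Replacing the
    binomials by orthogonal polynomials multiplies all minors by the same product of leading
    coefficients. The total number of tilings therefore appears as the product of the norms over the
    squared leading coefficients, and it remains to recognise the triple product in it. The final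
    induction on [n] keeps [s = n + m] fixed, not [m]. As functions of [s ^ 2], the summands then
    have simple poles at the squares [(h + 1) ^ 2]; with suitable polynomial multipliers the poles
    for [n] and [n + 1] cancel, and what remains does not involve [s]. This remainder is the sum
    that telescopes. *)

Definition matchings (T : finType) (e : rel T) (A : {set T}) :
    {set {set {set T}}} :=
  [set P | partition P A
         & [forall B in P, [exists s, exists t, e s t && (B == [set s; t])]]].

Definition num_matchings (T : finType) (e : rel T) (A : {set T}) : nat :=
  #|matchings e A|.

Section Matchings.
Variables (T : finType) (e : rel T).
Hypotheses (e_sym : symmetric e) (e_irr : irreflexive e).
Implicit Types (A B Y : {set T}) (P : {set {set T}}).

Local Notation nm := (num_matchings e).

Lemma num_matchings0 : nm set0 = 1.
Proof.
rewrite /num_matchings (_ : matchings e set0 = [set set0]) ?cards1 //.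
apply/setP=> P; rewrite !inE partition_set0.
apply: andb_idr => /eqP->; apply/forall_inP=> B; by rewrite inE.
Qed.

Lemma ltn_card_setD A B x : x \in A -> x \in B -> #|A :\: B| < #|A|.
Proof.
move=> xA xB; apply: proper_card; rewrite properEneq subsetDl andbT.
by apply/eqP=> /setP /(_ x); rewrite !inE xB xA.
Qed.

Lemma sub_cover P B : B \in P -> B \subset cover P.
Proof. by move=> BP; apply: (bigcup_sup B). Qed.

(** Deleting and adding the block [[set x; y]] are mutually inverse. *)
Lemma card_matchings_containing A x y : x \in A -> y \in A -> e x y ->
  #|[set P in matchings e A | [set x; y] \in P]| = nm (A :\: [set x; y]).
Proof.
move=> xA yA exy; pose B := [set x; y].
have BA : B \subset A by rewrite subUset !sub1set xA.
transitivity #|[set B |: P | P in matchings e (A :\: B)]|; last first.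
  apply: card_in_imset.
  have nB P : P \in matchings e (A :\: B) -> B \notin P.
    rewrite inE => /andP[/and3P[/eqP cP _ _] _]; apply/negP=> BP.
    have /subsetP/(_ x) := sub_cover BP; rewrite cP.
    by rewrite !inE eqxx => /(_ isT).
  move=> P Q hP hQ; have [BP BQ] := (nB P hP, nB Q hQ).
  by move/(congr1 (fun S => S :\ B)); rewrite !setU1K.
apply: eq_card => P; rewrite inE; apply/andP/imsetP.
  case; rewrite inE => /andP[/and3P[/eqP cP tP n0] /forall_inP rP] BP.
  exists (P :\ B); last by rewrite setD1K.
  rewrite inE; apply/andP; split; last first.
    by apply/forall_inP=> C; rewrite inE => /andP[_ /rP].
  apply/and3P; split.
  - by rewrite coverD1 // cP.
  - by apply: trivIsetS tP; apply: subD1set.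
  - by rewrite inE (negbTE n0) andbF.
case=> Q; rewrite inE => /andP[/and3P[/eqP cQ tQ n0] /forall_inP rQ] ->.
rewrite !inE eqxx; split=> //; apply/andP; split; last first.
  apply/forall_inP=> C; rewrite !inE => /orP[/eqP->|/rQ//].
  by apply/existsP; exists x; apply/existsP; exists y; rewrite exy eqxx.
have dB C : C \in Q -> [disjoint B & C].
  move=> CQ; rewrite disjoints_subset; apply/subsetP=> z zB; rewrite inE.
  by apply/negP=> zC; have /subsetP/(_ z zC) := sub_cover CQ; rewrite cQ inE zB.
apply/and3P; split.
- by rewrite /cover bigcup_setU big_set1 -/(cover Q) cQ setDE setUIr setUCr
  setIT;
    apply/eqP/setUidPr.
- by have [] := trivIsetU1 dB tQ n0.
- by rewrite !inE negb_or n0 andbT eq_sym; apply/eqP=> /setP /(_ x);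
  rewrite !inE eqxx.
Qed.

(** Classification by the partner of [x]: it is unique since blocks are disjoint, symmetry of [e]
    allows [x] to be taken as the first end, and irreflexivity keeps the two ends distinct. *)
Lemma num_matchings_rec A x : x \in A ->
  nm A = \sum_(y in A | e x y) nm (A :\: [set x; y]).
Proof.
move=> xA.
transitivity (\sum_(y in A | e x y) \sum_(P in matchings e A) ([set x;
  y] \in P)).
  rewrite exchange_big /= /num_matchings -sum1_card; apply: eq_bigr => P.
  rewrite inE => /andP[/and3P[/eqP cP tP n0] /forall_inP rP].
  have: x \in cover P by rewrite cP.
  move=> /bigcupP[B BP xB].
  have [y exy eB] : exists2 y, e x y & B = [set x; y].
    have /existsP[s /existsP[t /andP[est /eqP eB]]] := rP _ BP.
    move: xB; rewrite eB !inE => /orP[]/eqP->; first by exists t.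
    by exists s; rewrite 1?e_sym // setUC.
  have yA : y \in A by rewrite -cP; apply/bigcupP; exists B;
    rewrite // eB !inE eqxx orbT.
  rewrite (bigD1 y) /=; last by rewrite yA.
  rewrite -eB BP big1 // => z /andP[/andP[zA exz] zy]; apply/eqP.
  rewrite eqb0; apply/negP => xzP.
  have := trivIsetP tP _ _ BP xzP; case: eqP => [|_ /(_ isT)].
    move=> /esym; rewrite eB => /setP /(_ z);
      rewrite !inE eqxx orbT (negbTE zy) orbF.
    by move=> /esym/eqP zx; move: exz; rewrite zx e_irr.
  by rewrite disjoints_subset => /subsetP /(_ x xB); rewrite !inE eqxx.
apply: eq_bigr => y /andP[yA exy].
rewrite -card_matchings_containing // -sum1_card big_mkcond [RHS]big_mkcond /=.
by apply: eq_bigr => P _; rewrite [in RHS]inE;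
  case: (P \in matchings e A) => //=; case: ([set x; y] \in P).
Qed.

Lemma num_matchings_imset (f : T -> T) A : injective f ->
  {mono f : x y / e x y} -> nm (f @: A) = nm A.
Proof.
move=> f_inj f_mono.
have [k] := ubnP #|A|; elim: k => // k IHk in A *.
have [->|[x xA]] := set_0Vmem A; first by rewrite imset0.
rewrite ltnS => leAk.
rewrite (num_matchings_rec (imset_f f xA)) (num_matchings_rec xA).
rewrite -big_filter_cond big_filter_cond.
rewrite big_mkcondr /= big_imset /=; last by move=> ? ? _ _ /f_inj.
rewrite [RHS]big_mkcondr /=; apply: eq_bigr => y yA; rewrite f_mono.
case: ifP => // exy; rewrite -[in RHS]IHk; last first.
    by apply: leq_trans leAk; apply: (ltn_card_setD xA); rewrite !inE eqxx.
congr num_matchings; apply/setP=> z; rewrite !inE.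
apply/andP/imsetP=> [[zxy /imsetP[w wA zw]]|[w]].
  by exists w => //; rewrite !inE wA andbT; apply: contra zxy => /orP[]/eqP<-;
    rewrite zw eqxx ?orbT.
by rewrite !inE => /andP[wxy wA] ->; rewrite imset_f // !(inj_eq f_inj).
Qed.

(* The sum is over the sets Y of left ends of the edges joining A to B. *)
Lemma num_matchings_split (c : T -> T) A B : injective c -> [disjoint A & B] ->
  (forall x y, x \in A -> y \in B -> e x y -> y = c x) ->
  nm (A :|: B) = \sum_(Y : {set T} | (Y \subset A) &&
      [forall x in Y, (c x \in B) && e x (c x)]) nm (A :\: Y) * nm (B :\: c @:
        Y).
Proof.
move=> c_inj; have [k] := ubnP #|A|; elim: k => // k IHk in A B *.
move=> leAk dAB cross.
pose valid (C D Y : {set T}) :=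
  (Y \subset C) && [forall x in Y, (c x \in D) && e x (c x)].
have [A0|[x xA]] := set_0Vmem A.
  rewrite A0 set0U (bigD1 set0) /=; last first.
    by rewrite sub0set; apply/forall_inP=> y; rewrite inE.
  rewrite imset0 !setD0 num_matchings0 mul1n big1 ?addn0 // => Y.
  by rewrite subset0 => /andP[/andP[->]].
have xB : x \notin B by rewrite (disjointFr dAB xA).
have ltD (C : {set T}) : x \in C -> #|A :\: C| < k.
  by move=> xC; rewrite -ltnS; apply: leq_trans leAk; apply: (ltn_card_setD xA).
have dW (C D : {set T}) : C \subset A -> D \subset B -> [disjoint C & D].
  by move=> CA DB; apply: disjointWl CA (disjointWr DB dAB).
rewrite (@num_matchings_rec _ x); last by rewrite inE xA.
(* The partner of [x] lies in [A], which corresponds to the sets [Y] without [x], or it is [c x],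
   which corresponds to the sets [Y] with [x]. *)
rewrite (bigID (mem A)) /= [RHS](bigID (fun Y : {set T} => x \notin Y)) /=.
congr (_ + _).
  transitivity (\sum_(y in A | e x y) \sum_(Y | valid (A :\: [set x; y]) B Y)
      nm ((A :\: [set x; y]) :\: Y) * nm (B :\: c @: Y)).
    rewrite (eq_bigl (fun y => (y \in A) && e x y)); last first.
      by move=> y; rewrite inE; case: (y \in A); rewrite ?andbT ?andbF.
    apply: eq_bigr => y /andP[yA exy].
    have -> : (A :|: B) :\: [set x; y] = (A :\: [set x; y]) :|: B.
      apply/setP=> z; rewrite !inE; have [->|_] := eqVneq z x.
        by rewrite (negbTE xB).
      by have [->|//] := eqVneq z y; rewrite (disjointFr dAB yA).
    apply: IHk; first by apply: ltD; rewrite !inE eqxx.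
      by apply: dW; rewrite // subsetDl.
    by move=> u v /setDP[uA _]; apply: cross.
  rewrite (exchange_big_dep (fun Y => valid A B Y && (x \notin Y))) /=;
    last first.
    move=> y Y _ /andP[/subsetP YA vY]; apply/andP; split.
      by apply/andP; split=> //; apply/subsetP=> z /YA /setDP[].
    by apply/negP=> /YA; rewrite !inE eqxx.
  apply: eq_big => Y; first by [].
  case/andP=> /andP[YA vY] xY.
  rewrite -big_distrl /= (@num_matchings_rec (A :\: Y) x);
    last by rewrite inE xY.
  congr (_ * _); apply: eq_big => y; last by rewrite !setDDl [Y :|: _]setUC.
  rewrite /valid vY andbT subsetD YA /= inE.
  have -> : [disjoint Y & [set x; y]] = (y \notin Y).
    rewrite disjoints_subset; apply/subsetP/negP=> [h /h|h z zY].
      by rewrite !inE eqxx orbT.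
    by rewrite !inE; apply/negP=> /orP[]/eqP zE; move: zY xY h;
      rewrite zE => -> //.
  by case: (y \in Y); case: (y \in A); case: (e x y).
have [cxB|cxB] := boolP ((c x \in B) && e x (c x)); last first.
  rewrite !big_pred0 // => [Y|y].
    by apply/negbTE/negP=> /andP[/andP[_ /forall_inP vY]];
      rewrite negbK => /vY; apply/negP.
  apply/negbTE/negP=> /andP[/andP[]]; rewrite inE => /orP[->//|yB] exy _.
  by move: cxB; rewrite -(cross x y) // yB exy.
case/andP: cxB => cxB excx; rewrite (bigD1 (c x)) /=; last first.
  by rewrite inE cxB orbT excx (disjointFl dAB cxB).
rewrite big1 ?addn0; last first.
  move=> y /andP[/andP[/andP[]]]; rewrite inE => /orP[->//|yB] exy _.
  by rewrite (cross x y) // eqxx.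
have -> : (A :|: B) :\: [set x; c x] = (A :\ x) :|: (B :\ c x).
  apply/setP=> z; rewrite !inE; have [->|_] /= := eqVneq z x.
    by rewrite (negbTE xB) andbF.
  by have [->|//] := eqVneq z (c x); rewrite (disjointFl dAB cxB).
rewrite IHk; first last.
- by move=> u v /setDP[uA _] /setDP[vB _]; apply: cross.
- by apply: dW; apply: subsetDl.
- by apply: ltD; rewrite inE.
rewrite [RHS](reindex_onto (fun Y => x |: Y) (fun Y => Y :\ x)) /=; last first.
  by move=> Y /andP[_]; rewrite negbK; apply: setD1K.
apply: eq_big => Y.
  rewrite !inE eqxx /= andbT subsetD1 subUset sub1set xA /=.
  rewrite -[_ == Y]/(_ == _) -!andbA; case: (Y \subset A) => //=.
  have [xY|xY] := boolP (x \in Y) => /=.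
    symmetry; apply/negbTE; rewrite negb_and; apply/orP; right.
    by apply/eqP=> /setP /(_ x); rewrite !inE eqxx xY.
  rewrite setU1K // eqxx andbT; apply/forall_inP/forall_inP=> h z.
    rewrite !inE => /orP[/eqP->|zY]; first by rewrite cxB.
    by move: (h z zY); rewrite !inE => /andP[/andP[_ ->] ->].
  move=> zY; rewrite !inE (inj_eq c_inj).
  have -> /= : z != x by apply: contraNneq xY => <-.
  by apply: h; rewrite !inE zY orbT.
by move=> _; rewrite imsetU1 !setDDl.
Qed.
End Matchings.

(** * Tilings and the symmetry axis *)

Definition coords (N M : nat) (t : triangle N M) : nat * nat * bool :=
  (t.1.1 : nat, t.1.2 : nat, t.2).

(** The third neighbour has one coordinate lowered by one, so it is missing at [0]. The upper bounds
    on the coordinates are left to the places of use. *)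
Definition neighbours (u : nat * nat * bool) : seq (nat * nat * bool) :=
  let: (i, j, is_right) := u in
  if is_right then
    [:: (i, j, false); (i.+1, j, false)]
      ++ (if j is j'.+1 then [:: (i, j', false)] else [::])
  else
    [:: (i, j, true); (i, j.+1, true)]
      ++ (if i is i'.+1 then [:: (i', j, true)] else [::]).

Section Geometry.
Variables N M : nat.
Implicit Types (x y t : triangle N M).

Lemma coords_inj : injective (@coords N M).
Proof.
by move=> [[i j] b] [[i' j'] b'] [] /ord_inj-> /ord_inj-> ->.
Qed.

Lemma uniq_neighbours u : uniq (neighbours u).
Proof.
case: u => [[i j] []] /=; first by case: j => [|j]; rewrite /= !inE !xpair_eqE;
  lia.
by case: i => [|i]; rewrite /= !inE !xpair_eqE; lia.
Qed.

Lemma share_edgeE x y : share_edge x y = (coords y \in neighbours (coords x)).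
Proof.
case: x => [[[i p] [j q]] b]; case: y => [[[i' p'] [j' q']] b'].
rewrite /share_edge /coords /=.
move: i j i' j' {p q p' q'} => i j i' j'.
case: b; [case: j => [|j]|case: i => [|i]]; case: b';
  rewrite /= ?inE ?xpair_eqE ?(eqE true) ?(eqE false) /= ?andbT ?andbF ?orbF
    ?eqSS;
  try (case: (i' =P i) => ?; case: (i' =P i.+1) => ?; case: (i' =P i.+2) => ?;
    case: (i'.+1 =P i) => ?; rewrite /= ?andbT ?andbF ?orbF); lia.
Qed.

Lemma share_edge_sym : symmetric (@share_edge N M).
Proof.
move=> [[[i p] [j q]] b] [[[i' p'] [j' q']] b'];
  rewrite !share_edgeE /coords /=.
move: i j i' j' {p q p' q'} => i j i' j'.
by case: b; case: b'; [case: j => [|j]; case: j' => [|j']|case: j => [|j];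
  case: i' => [|i']
  |case: i => [|i]; case: j' => [|j']|case: i => [|i]; case: i' => [|i']];
  rewrite /= ?inE ?xpair_eqE ?(eqE true) ?(eqE false) /= ?andbT ?andbF ?orbF;
    lia.
Qed.

Lemma share_edge_irr : irreflexive (@share_edge N M).
Proof.
move=> [[i j] b]; rewrite share_edgeE /coords /=.
move: (i : nat) (j : nat) => {}i {}j.
by case: b; [case: j => [|j] | case: i => [|i]];
  rewrite /= ?inE ?xpair_eqE !andbF.
Qed.

Implicit Types P Q : pred (nat * nat * bool).

(** Predicates on natural number coordinates turn the comparison of regions into linear
    arithmetic. *)
Definition region P : {set triangle N M} := [set t | P (coords t)].

Definition region_tilings P : nat := num_matchings (@share_edge N M) (region P).

Lemma eq_region_tilings P Q :
  (forall i j b, i < N + M -> j < N + M -> P (i, j, b) = Q (i, j, b)) ->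
  region_tilings P = region_tilings Q.
Proof.
move=> eqPQ; congr num_matchings; apply/setP=> [[[i j] b]].
by rewrite !inE /coords /= eqPQ.
Qed.

Lemma region_tilings_rec P i j b : i < N + M -> j < N + M -> P (i, j, b) ->
  region_tilings P =
    \sum_(u <- neighbours (i, j, b) | [&& u.1.1 < N + M, u.1.2 < N + M & P u])
      region_tilings (fun v => [&& P v, v != (i, j, b) & v != u]).
Proof.
move=> iK jK Px; pose x : triangle N M := (Ordinal iK, Ordinal jK, b).
have xP : x \in region P by rewrite inE.
rewrite /region_tilings (num_matchings_rec share_edge_sym share_edge_irr xP).
rewrite -big_filter -[RHS]big_filter.
transitivity (\sum_(u <- map (@coords N M)
    (enum [set y in region P | share_edge x y]))
    region_tilings (fun v => [&& P v, v != (i, j, b) & v != u])).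
  rewrite big_map big_filter [RHS]big_enum_cond /=; apply: eq_big => y.
    by rewrite !inE andbT.
  move=> _; congr num_matchings; apply/setP=> z.
  by rewrite !inE -[(i, j, b)]/(coords x) !(inj_eq coords_inj) negb_or andbC.
apply: perm_big; apply: uniq_perm.
- by rewrite map_inj_uniq ?enum_uniq //; apply: coords_inj.
- by rewrite filter_uniq // uniq_neighbours.
move=> u; rewrite mem_filter; apply/mapP/idP.
  case=> y; rewrite mem_enum !inE share_edgeE -[(i, j, b)]/(coords x).
  by move=> /andP[Py xy] ->; rewrite xy Py !ltn_ord.
case/andP=> /and3P[]; case: u => [[i' j'] b'] /= iK' jK' Pu nu.
exists (Ordinal iK', Ordinal jK', b'); last by [].
by rewrite mem_enum !inE share_edgeE /coords /= Pu.
Qed.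

(* The part of the columns x <= - d sqrt(3)/2 of the left half of the hexagon;
   in the last column the left-pointing triangles with index in X are removed.
     *)
Definition left_part (d : nat) (X : seq nat) : pred (nat * nat * bool) :=
  fun u => let: (i, j, is_right) := u in
  if is_right then (i + d < j) && (j <= i + N)
  else ((i + d < j) || (j == i + d) && (i \notin X)) && (j < i + N).

Definition reflect_axis (t : triangle N M) : triangle N M :=
  (t.1.2, t.1.1, ~~ t.2).

Lemma reflect_axisK : involutive reflect_axis.
Proof. by case=> [[i j] b]; rewrite /reflect_axis /= negbK. Qed.

Lemma share_edge_reflect : {mono reflect_axis : x y / share_edge x y}.
Proof.
move=> [[[i p] [j q]] b] [[[i' p'] [j' q']] b'];
  rewrite !share_edgeE /coords /=.
move: i j i' j' {p q p' q'} => i j i' j'.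
by case: b; [case: j => [|j]|case: i => [|i]]; case: b';
  rewrite /= ?inE ?xpair_eqE ?(eqE true) ?(eqE false) /= ?andbT ?andbF ?orbF;
    lia.
Qed.

(** An edge across the axis can only join a triangle to its mirror image, so [num_matchings_split]
    applies with the reflection, and the two halves contribute equal factors. The size of [Z] is not
    restricted yet: sets of the wrong size will contribute 0. *)
Lemma card_tilings_axis_rhombus l : 0 < N -> l < N + M ->
  #|[set T in rhombus_tilings N M | axis_rhombus N M l \in T]| =
  \sum_(Z : {set 'I_(N + M)} | [exists i in Z, i == l :> nat])
     region_tilings (left_part 0 [seq val i | i <- enum Z]) ^ 2.
Proof.
move=> N0 lK; pose f := reflect_axis; pose o := Ordinal lK.
pose iota (i : 'I_(N + M)) : triangle N M := (i, i, false).
have iota_inj : injective iota by move=> i i' [].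
have fK : involutive f := reflect_axisK.
have f_inj : injective f := inv_inj fK.
have eqf x y : (x == f y) = (f x == y) by rewrite -(inj_eq f_inj) fK.
pose A := region (left_part 0 [::]).
have memf (B : {set triangle N M}) x : (x \in f @: B) = (f x \in B).
  by rewrite -{1}(fK x) (mem_imset _ _ f_inj).
have memA x : (x \in A) = left_part 0 [::] (coords x) by rewrite inE.
have dA : [disjoint A & f @: A].
  rewrite disjoints_subset; apply/subsetP=> x;
    rewrite [in X in _ -> X]inE memf !memA.
  by case: x => [[i j] []] /=; lia.
have hexE : hexagon N M = A :|: f @: A.
  apply/setP=> [[[[i p] [j q]] b]]; rewrite in_setU memf !memA inE /in_hexagon
    /=.
  by case: b => /=; lia.
have cross x y : x \in A -> y \in f @: A -> share_edge x y -> y = f x.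
  rewrite memf !memA share_edgeE => Ax Ay xy; apply: coords_inj; move: Ax Ay xy.
  case: x y => [[[i p] [j q]] b] [[[i' p'] [j' q']] b']; rewrite /coords /=.
  move: i j i' j' {p q p' q'} => i j i' j'.
  case: b; [case: j => [|j]|case: i => [|i]]; case: b';
    rewrite /= ?inE ?xpair_eqE ?(eqE true) ?(eqE false) /= ?andbT ?andbF ?orbF
      => ? ? ?;
    by try (congr (_, _, _); lia); lia.
have axis x : x \in A -> share_edge x (f x) = (x \in iota @: setT).
  move=> Ax; transitivity (~~ x.2 && (x.1.1 == x.1.2 :> nat)).
    move: Ax; rewrite memA share_edgeE.
    case: x => [[[i p] [j q]] b]; rewrite /coords /=.
    move: i j {p q} => i j.
    by case: b; [case: j => [|j]|case: i => [|i]];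
      rewrite /= ?inE ?xpair_eqE ?(eqE true) ?(eqE false) /= ?andbT ?andbF
        ?orbF => ?; lia.
  case: x {Ax} => [[i j] b]; apply/andP/imsetP =>
    /= [[/negbTE-> /eqP /val_inj->]|].
    by exists j.
  by case=> k _ [-> -> ->].
have iotaA i : iota i \in A by rewrite memA /=; lia.
have axisE : axis_rhombus N M l = [set iota o; f (iota o)].
  apply/setP=> [[[[i p] [j q]] b]].
  rewrite !inE -!(inj_eq coords_inj) /coords /= !xpair_eqE.
  by case: b; rewrite /= ?inE ?xpair_eqE ?(eqE true) ?(eqE false) /= ?andbT
    ?andbF ?orbF; lia.
(* The rhombus at level [l] is taken out of both halves before splitting; the reindexing by [o |: Z]
   puts its position back. *)
pose A' := A :\ iota o.
rewrite axisE -[rhombus_tilings N M]/(matchings (@share_edge N M) (hexagon N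
  M)).
rewrite card_matchings_containing; first last.
- by rewrite axis // imset_f.
- by rewrite hexE inE imset_f ?orbT.
- by rewrite hexE inE iotaA.
have -> : hexagon N M :\: [set iota o; f (iota o)] = A' :|: f @: A'.
  apply/setP=> x; rewrite hexE !(in_setD1, in_setD, in_setU, in_set1, memf) eqf.
  have [->|_] := eqVneq x (iota o); first
    by rewrite -memf (disjointFr dA) // andbF.
  by have [xo|//] := eqVneq (f x) (iota o);
    rewrite xo (disjointFl dA) // memf xo.
rewrite (num_matchings_split share_edge_sym share_edge_irr f_inj); first last.
- by move=> x y /setD1P[_ xA]; rewrite memf => /setD1P[_]; rewrite -memf;
  apply: cross.
- by apply: disjointWl (subD1set _ _) (disjointWr _ dA); apply/imsetS/subD1set.
rewrite (reindex_onto (fun Z : {set 'I_(N + M)} => iota @: Z) (fun Y =>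
  iota @^-1: Y)) /=; last first.
  move=> Y /andP[/subsetP YA /forall_inP vY]; apply/setP=> x.
  apply/imsetP/idP=> [[i]|xY]; first by rewrite inE => ? ->.
  have /andP[_] := vY x xY; rewrite axis; last by have /setD1P[] := YA x xY.
  by case/imsetP=> i _ xi; exists i; rewrite // inE -xi.
rewrite [RHS](reindex_onto (fun Z : {set 'I_(N + M)} => o |: Z) (fun Z =>
  Z :\ o)) /=; last first.
  move=> Z /exists_inP[i iZ il]; rewrite setD1K // (_ : o = i) //.
  by apply: val_inj; rewrite /= (eqP il).
apply: eq_big => Z.
  have -> : iota @^-1: (iota @: Z) == Z by apply/eqP/setP=> i;
    rewrite inE mem_imset.
  have -> : [exists i in o |: Z, i == l :> nat].
    by apply/exists_inP; exists o; rewrite ?inE ?eqxx.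
  rewrite andbT /=; have [oZ|oZ] := boolP (o \in Z).
    transitivity false.
      by apply/negbTE/negP=> /andP[/subsetP /(_ (iota o))];
        rewrite imset_f // !inE eqxx => /(_ isT).
    symmetry; apply/eqP=> /setP /(_ o); by rewrite !inE eqxx oZ.
  rewrite setU1K // eqxx; apply/andP.
  have YA : iota @: Z \subset A'.
    apply/subsetP=> x /imsetP[i iZ ->]; rewrite !inE (inj_eq iota_inj) -memA
      iotaA andbT.
    by apply: contraNneq oZ => <-.
  split=> //; apply/forall_inP=> x xY; rewrite imset_f ?(subsetP YA) // axis.
    by apply: (subsetP (imsetS _ (subsetT Z))).
  by have := subsetP YA x xY; case/setD1P.
move=> _.
have -> : f @: A' :\: f @: (iota @: Z) = f @: (A' :\: iota @: Z).
  by apply/setP=> x; rewrite !(in_setD, memf).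
rewrite (num_matchings_imset share_edge_sym share_edge_irr _ f_inj
  share_edge_reflect).
rewrite mulnn; congr (num_matchings _ _ ^ 2); apply/setP=> x.
rewrite in_setD in_setD1 memA [in RHS]inE; case: x => [[i j] b].
have -> : ((i, j, b) \in iota @: Z) = [&& ~~ b, i == j & i \in Z].
  apply/imsetP/and3P => [[k kZ [-> -> ->]]|[/negbTE-> /eqP-> jZ]]; first by [].
  by exists j.
have -> : ((i, j, b) == iota o) = [&& ~~ b, i == j & i == o].
  rewrite /iota !xpair_eqE; case: b; rewrite ?andbF ?andbT //=.
  by apply/andP/andP=> -[/eqP-> /eqP->].
rewrite /coords /= mem_map; last exact: val_inj.
rewrite mem_enum in_setU1 -[i == j]/(i == j :> nat).
by case: b => /=; case: (i == o); case: (i \in Z); lia.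
Qed.

End Geometry.

(** * Interlacing sequences *)

(* The increasing sequences X with b <= X_0 < Y_0 <= X_1 < Y_1 <= ... *)
Fixpoint interlacing (b : nat) (Y : seq nat) : seq (seq nat) :=
  if Y is y :: Y' then
    [seq x :: X | x <- index_iota b y, X <- interlacing y Y']
  else [:: [::]].

Section Strips.
Variables N M : nat.
Local Notation tilings := (region_tilings N M).
Local Notation left_part := (left_part N).

(* left_part d.+1 X together with the part of the strip to its right that
   consists of the right-pointing triangles with index at least b and of the
   left-pointing ones with index at least c and not in Y. *)
Definition strip_part (d : nat) (X Y : seq nat) (b c : nat) :
    pred (nat * nat * bool) :=
  fun u => let: (i, j, is_right) := u in
  if is_right then
    ((i + d.+1 < j) || (j == i + d.+1) && (b <= i)) && (j <= i + N)
  else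
    [|| i + d.+1 < j, (j == i + d.+1) && (i \notin X)
      | [&& j == i + d, c <= i & i \notin Y]] && (j < i + N).

Lemma left_part_strip d X :
  tilings (left_part d X) = tilings (strip_part d [::] X 0 0).
Proof. by apply: eq_region_tilings => i j [] _ _ /=; lia. Qed.

Lemma eq_strip_part d X Y Y' b c :
  (forall i, c <= i -> (i \in Y) = (i \in Y')) ->
  tilings (strip_part d X Y b c) = tilings (strip_part d X Y' b c).
Proof.
move=> eqY; apply: eq_region_tilings => i j [] _ _ //=.
by have [ci|] := leqP c i; rewrite ?andbF // (eqY i ci).
Qed.

Lemma strip_part_removed d X Y b : b \in Y ->
  tilings (strip_part d X Y b b) = tilings (strip_part d X Y b b.+1).
Proof.
move=> bY; apply: eq_region_tilings => i j [] _ _ //=.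
by have [->|ib] := eqVneq i b; rewrite ?bY ?andbF ?orbF //;
  congr [&& [|| _, _ | [&& _, _ & _]] & _]; lia.
Qed.

Lemma strip_part_last d X Y b c : N + M <= b + d.+1 -> b < c ->
  tilings (strip_part d X Y b c) = tilings (left_part d.+1 X).
Proof.
by move=> Kb bc; apply: eq_region_tilings => i j [] ? ? /=; case: (i \in X);
  case: (i \in Y); lia.
Qed.

(** Going upwards, the strip alternates between left-pointing and right-pointing triangles. If the
    lowest one is left-pointing, its only possible partner is the right-pointing one of the same
    index. *)
Lemma strip_part_left_step d X Y b : d < N -> b + d.+1 < N + M -> b \notin Y ->
  tilings (strip_part d X Y b b) = tilings (strip_part d X Y b.+1 b.+1).
Proof.
move=> dN bK bY.
rewrite (@region_tilings_rec _ _ _ b (b + d) false); last first.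
- by rewrite /= bY; lia.
- by lia.
- by lia.
transitivity (tilings (fun v => [&& strip_part d X Y b b v, v != (b, b + d,
  false)
    & v != (b, b + d.+1, true)])).
  by case: b bK bY => [|b] bK bY; rewrite /= !big_cons big_nil /=;
    do ?[case: ifP => [?|?]; try by lia]; rewrite ?addn0 ?addnS.
apply: eq_region_tilings => i j f _ _; rewrite !xpair_eqE.
have [->|ib] := eqVneq i b; case: f; rewrite ?(eqE true) ?(eqE false) /= ?bY.
- by lia.
- by case: (b \in X); lia.
- by lia.
- by case: (i \in X); case: (i \in Y); lia.
Qed.

(** The path ends at the top with a left-pointing triangle, which has no partner once it is
    alone. *)
Lemma strip_part_left_last d X Y b : d < N -> b + d.+1 = N + M -> b \notin Y ->
  tilings (strip_part d X Y b b) = 0.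
Proof.
move=> dN bK bY.
rewrite (@region_tilings_rec _ _ _ b (b + d) false); last first.
- by rewrite /= bY; lia.
- by lia.
- by lia.
by case: b bK bY => [|b] bK bY; rewrite /= !big_cons big_nil /=;
    do ?[case: ifP => [?|?]; try by lia].
Qed.

(** If the lowest triangle is right-pointing, either it is paired across the line to its left, which
    puts [b] into [X] and requires a further column ([d.+1 < N]), or it is paired with the next
    left-pointing triangle, unless [Y] has removed that one. *)
Lemma strip_part_right_step d X Y b : d < N -> b + d.+1 < N + M -> b \notin X ->
  tilings (strip_part d X Y b b.+1) =
    (d.+1 < N) * tilings (strip_part d (b :: X) Y b.+1 b.+1)
    + (b.+1 \notin Y) * tilings (strip_part d X Y b.+1 b.+2).
Proof.
move=> dN bK bX.
rewrite (@region_tilings_rec _ _ _ b (b + d.+1) true); last first.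
- by rewrite /=; lia.
- by lia.
- by lia.
rewrite addnS /= !big_cons big_nil /=.
rewrite (_ : [&& _, _ & _] = (d.+1 < N)); last by rewrite bX; case: (b \in Y);
  lia.
rewrite (_ : [&& b.+1 < _, _ & _] = (b.+1 \notin Y));
  last by case: (b.+1 \in X); case: (b.+1 \in Y); lia.
rewrite (_ : [&& _, b + d < _ & _] = false); last by case: (b \in X);
  case: (b \in Y); lia.
rewrite addn0.
have -> (B : bool) p q : (if B then p + q else q) = B * p + q by case: B; lia.
have -> (B : bool) p : (if B then p else 0) = B * p by case: B; lia.
congr (_ + _); [case: ltnP => // dN' | case: (boolP (b.+1 \in Y)) => // bY];
  rewrite !mul1n; apply: eq_region_tilings => i j f _ _;
    rewrite !xpair_eqE ?inE.
  have [->|ib] := eqVneq i b; case: f; rewrite ?(eqE true) ?(eqE false) /= ?inE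
    ?bX;
    by case: (b \in Y); case: (i \in X); case: (i \in Y); lia.
have [->|ib] := eqVneq i b.+1; case: f; rewrite ?(eqE true) ?(eqE false) /=
  ?(negbTE bY);
    by case: (b \in Y); case: (b.+1 \in X); case: (i \in X); case: (i \in Y);
      lia.
Qed.

Lemma eq_left_part d X X' : X =i X' ->
  tilings (left_part d X) = tilings (left_part d X').
Proof. by move=> eqX; apply: eq_region_tilings => i j [] _ _ //=;
  rewrite eqX. Qed.

Lemma left_part_last X : tilings (left_part N X) = 1.
Proof.
rewrite -(num_matchings0 (@share_edge N M)); congr num_matchings.
by apply/setP=> [[[i j] []]]; rewrite !inE /=;
  case: (nat_of_ord i \in X) => /=; lia.
Qed.

Lemma strip_part_left_nil d X b : d < N -> b + d.+1 <= N + M ->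
  tilings (strip_part d X [::] b b) = 0.
Proof.
move=> dN; elim: {b}(N + M - (b + d.+1)) {-2}b (erefl (N + M - (b + d.+1))) =>
  [|k IHk] b kE bK.
  by apply: strip_part_left_last => //; lia.
rewrite strip_part_left_step //; last by lia.
by apply: IHk; lia.
Qed.

Lemma strip_part_right_nil d X b : d < N -> b + d.+1 <= N + M ->
  all (fun x => x < b) X ->
  tilings (strip_part d X [::] b b.+1) = tilings (left_part d.+1 X).
Proof.
move=> dN; elim: {b}(N + M - (b + d.+1)) {-2}b (erefl (N + M - (b + d.+1))) =>
  [|k IHk] b kE bK bX.
  by apply: strip_part_last; lia.
rewrite strip_part_right_step //; last by apply/negP=> /(allP bX); lia.
  rewrite strip_part_left_nil ?muln0 ?mul1n //; last by lia.
  by apply: IHk; [lia|lia|apply: sub_all bX => x; lia].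
by lia.
Qed.

(** Below the first hole [y] all pairs are forced; the hole then leaves the right-pointing triangle
    of index [y] at the bottom. *)
Lemma strip_part_skip d X Y b y : d < N -> b <= y -> y + d.+1 <= N + M ->
  path ltn y Y ->
  tilings (strip_part d X (y :: Y) b b) = tilings (strip_part d X Y y y.+1).
Proof.
move=> dN by_ yK yY; have nY x : x < y -> x \notin y :: Y.
  move=> xy; rewrite inE negb_or; apply/andP; split; first by lia.
  by apply/negP=> /(allP (order_path_min ltn_trans yY)); lia.
elim: {b}(y - b) {-2}b (erefl (y - b)) by_ => [|k IHk] b kE by_.
  have -> : b = y by lia.
  rewrite strip_part_removed ?mem_head //; apply: eq_strip_part => i.
  by rewrite inE; have [->|] := eqVneq i y; rewrite // ltnn.
rewrite strip_part_left_step ?nY //; [|lia|lia].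
by apply: IHk; lia.
Qed.

(** Between two consecutive holes there is one more right-pointing than left-pointing triangle, and
    the left-pointing ones find partners only inside the strip: exactly one rhombus crosses. Above
    the last hole the numbers agree and none crosses. For [d.+1 = N] there is no column to cross
    into, whence the boolean factor. *)
Lemma strip_part_right_sum d X Y b : d < N -> b + d.+1 <= N + M ->
  all (fun x => x < b) X -> path ltn b Y ->
  all (fun y => y + d.+1 <= N + M) Y ->
  tilings (strip_part d X Y b b.+1) =
    \sum_(X' <- interlacing b Y)
      ((d.+1 < N) || nilp X') * tilings (left_part d.+1 (X' ++ X)).
Proof.
move=> dN; elim: Y b X => [|y Y IHY] b X bK bX.
  by rewrite big_seq1 orbT mul1n strip_part_right_nil.
move=> /= /andP[ltby yY] /andP[yK YK].
transitivity (\sum_(b <= x < y)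
    (d.+1 < N) * tilings (strip_part d (x :: X) Y y y.+1)).
  elim: {b}(y - b) {-2}b (erefl (y - b)) bK bX ltby => [|k IHk] b kE bK bX ltby.
    by lia.
  rewrite big_ltn // strip_part_right_step //; first last.
  - by apply/negP=> /(allP bX); lia.
  - by lia.
  rewrite strip_part_skip //; congr (_ + _).
  have [->|b1y] := eqVneq b.+1 y; first by rewrite mem_head big_geq.
  have -> : b.+1 \notin y :: Y.
    rewrite inE (negbTE b1y); apply/negP=> /(allP (order_path_min ltn_trans
      yY)); lia.
  rewrite mul1n; apply: IHk; [lia|lia| |lia].
  by apply: sub_all bX => x; lia.
rewrite big_allpairs_dep /= big_seq [RHS]big_seq; apply: eq_bigr => x.
rewrite mem_index_iota => /andP[bx xy].
rewrite IHY //=; last first.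
  by rewrite xy; apply: sub_all bX => z; lia.
rewrite big_distrr; apply: eq_bigr => X' _ /=.
rewrite orbF (@eq_left_part _ _ (x :: X' ++ X)); last first.
  by move=> z; rewrite !(mem_cat, inE) orbCA.
by case: (d.+1 < N); rewrite ?mul1n ?mul0n.
Qed.

Lemma left_part_nil d : d < N -> tilings (left_part d [::]) = 0.
Proof. by move=> dN; rewrite left_part_strip strip_part_left_nil //; lia. Qed.

Lemma left_part_cons d y Y : d < N -> path ltn y Y ->
  all (fun z => z + d.+1 <= N + M) (y :: Y) ->
  tilings (left_part d (y :: Y)) =
    \sum_(X <- interlacing y Y)
      ((d.+1 < N) || nilp X) * tilings (left_part d.+1 X).
Proof.
move=> dN yY /= /andP[yK YK].
rewrite left_part_strip strip_part_skip // strip_part_right_sum //.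
by apply: eq_bigr => X _; rewrite cats0.
Qed.
End Strips.

(** * Interlacing sums of binomial determinants *)

Lemma size_interlacing b Y X : X \in interlacing b Y -> size X = size Y.
Proof.
elim: Y b X => [|y Y IH] b X /=; first by rewrite inE => /eqP->.
by move=> /allpairsPdep[x [X' [_ /IH sX' ->]]] /=; rewrite sX'.
Qed.

Lemma interlacing_path b Y X : X \in interlacing b Y ->
  path ltn b Y -> all (fun x => b <= x) X /\ sorted ltn X.
Proof.
elim: Y b X => [|y Y IH] b X /=; first by rewrite inE => /eqP->.
move=> /allpairsPdep[x [X' [xby /IH XY ->]]] /andP[ltby /XY [yX' sX']] /=.
move: xby; rewrite mem_index_iota => /andP[-> xy]; split.
  by apply: sub_all yX' => z; lia.
by rewrite path_sortedE ?sX' ?andbT; [apply: sub_all yX' => z;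
  lia | exact: ltn_trans].
Qed.

Lemma interlacing_lt b Y X k : X \in interlacing b Y ->
  all (fun y => y <= k) Y -> all (fun x => x < k) X.
Proof.
elim: Y b X => [|y Y IH] b X /=; first by rewrite inE => /eqP->.
move=> /allpairsPdep[x [X' [xby /IH XY ->]]] /andP[yk /XY /= ->].
by move: xby; rewrite mem_index_iota andbT; lia.
Qed.

Local Open Scope ring_scope.

(** Interlacing confines each entry of [X] to its own interval between consecutive entries of
    [b :: Y], independently of the other entries. *)
Lemma sum_interlacing_prod (R : comNzRingType) (f : nat -> nat -> R) b Y :
  \sum_(X <- interlacing b Y) \prod_(i < size Y) f i (nth 0%N X i) =
  \prod_(i < size Y) \sum_(nth 0%N (b :: Y) i <= x < nth 0%N Y i) f i x.
Proof.
elim: Y b f => [|y Y IH] b f; first by rewrite big_seq1 !big_ord0.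
rewrite big_allpairs_dep /= [RHS]big_ord_recl /= big_distrl /=.
apply: eq_bigr => x _.
rewrite -(IH y (fun i => f i.+1)) big_distrr /=.
by apply: eq_bigr => X _; rewrite big_ord_recl.
Qed.

Definition binomial_mx (k : nat) (Y : seq nat) : 'M[rat]_k :=
  \matrix_(i, j) 'C(nth 0%N Y i, j)%:R.

Lemma sum_binomial (a b j : nat) : (a <= b)%N ->
  \sum_(a <= x < b) 'C(x, j)%:R = 'C(b, j.+1)%:R - 'C(a, j.+1)%:R :> rat.
Proof.
move=> ab; rewrite -(telescope_sumr (fun x => 'C(x, j.+1)%:R)) //.
by apply: eq_bigr => x _; rewrite binS natrD addrC addKr.
Qed.

(** Summing row [i] over its interval turns column [j] into a difference of the values of
    ['C(_, j.+1)] at consecutive entries of [y :: Y]. The same differences arise on the right by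
    subtracting from each row its predecessor, which also reduces the constant column [j = 0] to a
    single 1. *)
Lemma sum_interlacing_det y Y : path ltn y Y ->
  \sum_(X <- interlacing y Y) \det (binomial_mx (size Y) X)
    = \det (binomial_mx (size Y).+1 (y :: Y)).
Proof.
move=> yY; pose z := nth 0%N (y :: Y).
have zS (i : 'I_(size Y)) : (z i <= z i.+1)%N.
  by apply/ltnW; have /pathP := yY; apply.
transitivity (\det (\matrix_(i < size Y, j < size Y)
    ('C(z i.+1, j.+1)%:R - 'C(z i, j.+1)%:R : rat))).
  rewrite exchange_big /=; apply: eq_bigr => s _.
  rewrite -big_distrr /=; congr (_ * _).
  under eq_bigr do under eq_bigr do rewrite mxE.
  (* [sum_interlacing_prod] takes functions indexed by all naturals; the value [0%N] beyond [size Y]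
     is a dummy. *)
  pose f n x : rat := 'C(x, oapp (fun i : 'I_(size Y) =>
    s i : nat) 0%N (insub n))%:R.
  have fE (i : 'I_(size Y)) x : f i x = 'C(x, s i)%:R by rewrite /f valK.
  under eq_bigr do under eq_bigr do rewrite -fE.
  rewrite sum_interlacing_prod; apply: eq_bigr => i _; rewrite mxE.
  under eq_bigr do rewrite fE.
  by rewrite sum_binomial // zS.
pose E : 'M[rat]_((size Y).+1) := \matrix_(i, j) ((i == j)%:R - (i == j.+1 :>
  nat)%:R).
have detE : \det E = 1.
  rewrite det_trig; last first.
    by apply/is_trig_mxP=> i j ij; rewrite !mxE -val_eqE /= !ltn_eqF ?subrr //;
      lia.
  by rewrite big1 // => i _; rewrite !mxE eqxx ltn_eqF ?subr0.
transitivity (\det (E *m binomial_mx (size Y).+1 (y :: Y))); last first.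
  by rewrite det_mulmx detE mul1r.
rewrite (expand_det_col _ ord0).
have EE i j : (E *m binomial_mx (size Y).+1 (y :: Y)) i j =
    'C(z i, j)%:R - (if (0 < i)%N then 'C(z i.-1, j)%:R else 0).
  rewrite mxE; under eq_bigr do rewrite !mxE mulrBl.
  rewrite sumrB; congr (_ - _).
    rewrite (bigD1 i) //= eqxx mul1r big1 ?addr0 // => k ki.
    by rewrite eq_sym (negbTE ki) mul0r.
  case: posnP => [i0|i0]; first by rewrite big1 // => k _; rewrite i0 mul0r.
  have i1 : (i.-1 < (size Y).+1)%N by case: (i) i0 => -[|k] //= /ltnW.
  rewrite (bigD1 (Ordinal i1)) //= prednK // eqxx mul1r big1 ?addr0 // => k ki.
  rewrite (_ : (i == k.+1 :> nat) = false) ?mul0r //.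
  by apply: contraNF ki => /eqP ik; apply/eqP/val_inj; rewrite /= ik.
rewrite big_ord_recl EE /= !bin0 subr0 mul1r big1 ?addr0; last first.
  by move=> i _; rewrite EE /= !bin0 subrr mul0r.
rewrite /cofactor expr0 mul1r; congr (\det _); apply/matrixP=> i j.
by rewrite [LHS]mxE [RHS]mxE [RHS]mxE EE /= /bump !add1n.
Qed.

(** Here [k] counts the remaining strips, and it is also the number of holes that a tilable region
    must have; [M + k] is the length of its last column. For [k = 0] the region is empty and has one
    tiling whatever [Y] is, so [Y] has to be required empty there. *)
Lemma tilings_left_part N M k Y : (k <= N)%N -> (k == 0%N) ==> nilp Y ->
  sorted ltn Y -> all (fun y => y < M + k)%N Y ->
  (region_tilings N M (left_part N (N - k) Y))%:R =
    if size Y == k then \det (binomial_mx k Y) else 0.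
Proof.
elim: k Y => [|k IHk] Y kN; first by rewrite subn0 => /nilP->;
  rewrite left_part_last det_mx00.
case: Y => [_ _ _|y Y _ sY YK]; first by rewrite left_part_nil //; lia.
rewrite left_part_cons //; [|lia|by apply: sub_all YK => z; lia].
rewrite natr_sum eqSS.
transitivity (\sum_(X <- interlacing y Y)
    if size Y == k then \det (binomial_mx k X) else 0); last first.
  have [<-|_] := eqVneq (size Y) k; first by rewrite sum_interlacing_det.
  by rewrite big1.
rewrite big_seq [RHS]big_seq; apply: eq_bigr => X XY.
rewrite -(size_interlacing XY) -subSn // subSS.
have [k0|k0] := boolP (k == 0%N); last first.
  rewrite (_ : (_ < N)%N) ?mul1n; last by lia.
  apply: IHk; rewrite ?(negbTE k0) //; first by lia.
    by have [] := interlacing_path XY sY.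
  apply: interlacing_lt XY _; move: YK => /= /andP[_]; apply: sub_all => z; lia.
rewrite (_ : (_ < N)%N = false) /=; last by lia.
have [/nilP->|X0] := boolP (nilp X); last by rewrite mul0n ifN // (eqP k0).
by rewrite mul1n IHk ?implybT //; lia.
Qed.

(** * The Cauchy-Binet formula *)

Section CauchyBinet.
Variables (R : comNzRingType) (L N : nat).

Definition sample_mx (f : 'I_N -> nat -> R) (Z : {set 'I_L}) : 'M[R]_N :=
  \matrix_(i, j) f j (nth 0%N [seq val x | x <- enum Z] i).

(** Multilinearity in the rows gives a sum over all maps [y] from rows to points. A non-injective
    [y] produces two equal rows; the injective ones with image [Z] are permutations of its
    enumeration, and their signs assemble a second copy of the minor. *)
Lemma Cauchy_Binet (w : 'I_L -> R) (f : 'I_N -> nat -> R) :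
  \det (\matrix_(i, j) \sum_(x < L) w x * f i x * f j x) =
  \sum_(Z : {set 'I_L} | #|Z| == N)
    (\prod_(x in Z) w x) * \det (sample_mx f Z) ^+ 2.
Proof.
transitivity (\sum_(y : {ffun 'I_N -> 'I_L})
    (\prod_(i < N) (w (y i) * f i (y i))) * \det (\matrix_(i, j) f j (y i))).
  under eq_bigr => y do rewrite /determinant big_distrr /=.
  rewrite exchange_big /=; apply: eq_bigr => s _.
  under eq_bigr => i do rewrite mxE.
  rewrite bigA_distr_bigA big_distrr /=; apply: eq_bigr => y _.
  rewrite mulrCA -big_split /=; congr (_ * _).
  by apply: eq_bigr => i _; rewrite mxE.
rewrite (bigID (fun y : {ffun 'I_N -> 'I_L} =>
  injectiveb y)) /= addrC big1 ?add0r; last first.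
  move=> y /injectivePn[i [j ij yij]].
  rewrite (determinant_alternate ij) ?mulr0 // => k.
  by rewrite !mxE yij.
rewrite (partition_big (fun y : {ffun 'I_N -> 'I_L} => y @: setT) (fun Z =>
  #|Z| == N)) /=; last first.
  by move=> y /injectiveP y_inj; rewrite card_imset // cardsT card_ord.
apply: eq_bigr => Z /eqP ZN.
pose z (i : 'I_N) : 'I_L := enum_val (cast_ord (esym ZN) i).
have zZ i : z i \in Z by apply: enum_valP.
have z_inj : injective z by move=> i j /enum_val_inj /cast_ord_inj.
have zE (i : 'I_N) : nth 0%N [seq val x | x <- enum Z] i = z i.
  by rewrite (nth_map (z i)) -?cardE ?ZN // [in RHS]/z (enum_val_nth (z i)).
pose h (s : 'S_N) : {ffun 'I_N -> 'I_L} := [ffun i => z (s i)].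
have h_inj : injective h.
  move=> s t /ffunP st; apply/permP=> k; apply: z_inj.
  by have := st k; rewrite !ffunE.
transitivity (\sum_(y in h @: setT)
    (\prod_(i < N) (w (y i) * f i (y i))) * \det (\matrix_(i, j) f j (y i))).
  apply: eq_bigl => y; apply/andP/imsetP => [[/injectiveP y_inj /eqP yZ]|[s _
    ->]].
    have yz i : exists k, z k == y i.
      have yi : y i \in Z by rewrite -yZ imset_f.
      exists (cast_ord ZN (enum_rank_in yi (y i))).
      by rewrite /z cast_ordK enum_rankK_in.
    pose g i := xchoose (yz i).
    have zg i : z (g i) = y i by apply/eqP/(xchooseP (yz i)).
    have g_inj : injective g by move=> i j gij; apply: y_inj; rewrite -!zg gij.
    exists (perm g_inj); rewrite ?inE //.
    by apply/ffunP=> i; rewrite ffunE permE zg.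
  have hs_inj : injective (h s) by move=> i j;
    rewrite !ffunE => /z_inj /perm_inj.
  split; first exact/injectiveP.
  rewrite eqEcard card_imset // cardsT card_ord ZN leqnn andbT.
  by apply/subsetP=> x /imsetP[i _ ->]; rewrite ffunE.
rewrite big_imset /=; last by move=> ? ? _ _; apply: h_inj.
have wE s : \prod_(i < N) w (h s i) = \prod_(x in Z) w x.
  rewrite (reindex_inj (@perm_inj _ s^-1)) /=.
  under eq_bigr => i do rewrite ffunE permKV.
  have -> : Z = z @: setT.
    apply/esym/eqP; rewrite eqEcard card_imset // cardsT card_ord ZN leqnn
      andbT.
    by apply/subsetP=> u /imsetP[i _ ->].
  rewrite big_imset /=; last by move=> ? ? _ _; apply: z_inj.
  by apply: eq_bigl => i; rewrite inE.
transitivity (\sum_(s : 'S_N) (\prod_(x in Z) w x) * (\det (sample_mx f Z) *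
    ((-1) ^+ s * \prod_(i < N) (sample_mx f Z)^T i (s i)))).
  apply: eq_big => s; first by rewrite inE.
  move=> _; rewrite big_split /= wE -mulrA; congr (_ * _).
  have -> : \matrix_(i, j) f j (h s i) = row_perm s (sample_mx f Z).
    by apply/matrixP=> i j; rewrite !mxE ffunE zE.
  rewrite row_permE det_mulmx det_perm mulrA mulrC [X in _ * X]mulrC.
  by congr (_ * (_ * _)); apply: eq_bigr => i _; rewrite !mxE ffunE zE.
rewrite -big_distrr -big_distrr /= expr2; congr (_ * (_ * _)).
by rewrite -[RHS]det_tr.
Qed.

End CauchyBinet.

(** * Squared minors through a given point *)

(** Both sides are the determinant of the bordered matrix with diagonal blocks [1] and [diag_mx h]
    and off-diagonal blocks [v] and [v^T], evaluated by the Schur complement of either diagonal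
    block. *)
Lemma det_diag_sub_rank1 (F : fieldType) (N : nat) (h v : 'rV[F]_N) :
  (forall i, h 0 i != 0) ->
  \det (diag_mx h - v^T *m v) =
    \prod_i h 0 i * (1 - \sum_i v 0 i ^+ 2 / h 0 i).
Proof.
move=> h0; pose h' : 'rV[F]_N := \row_i (h 0 i)^-1.
have hh' : diag_mx h' *m diag_mx h = 1%:M.
  rewrite mulmx_diag; apply/matrixP=> i j; rewrite !mxE mulVf //.
transitivity (\det (block_mx (1%:M : 'M_1) v v^T (diag_mx h))).
  transitivity (\det (block_mx (1%:M : 'M_1) 0 v^T 1%:M *m
                      block_mx 1%:M v 0 (diag_mx h - v^T *m v))).
    by rewrite det_mulmx det_lblock det_ublock !det1 !mul1r.
  by rewrite mulmx_block !mul1mx !mul0mx !mulmx1 !addr0 [v^T *m v + _]addrC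
    subrK.
transitivity (\det (block_mx (1%:M : 'M_1) (v *m diag_mx h') 0 1%:M *m
   block_mx (1%:M - v *m diag_mx h' *m v^T) 0 v^T (diag_mx h))).
  by rewrite mulmx_block !mul1mx !mul0mx !add0r -(mulmxA _ _ (diag_mx h)) hh'
    mulmx1 subrK.
rewrite det_mulmx det_ublock det_lblock !det1 !mul1r mulrC det_diag;
  congr (_ * _).
rewrite det_mx11 !mxE eqxx; congr (_ - _); apply: eq_bigr => i _.
rewrite mul_mx_diag !mxE; ring.
Qed.

(** All sets minus those avoiding [l]: the former carry the weight 1, the latter are selected by the
    weight that vanishes exactly at [l]. *)
Lemma sum_containing_det (F : fieldType) (L N : nat) (p : nat -> nat -> F)
    (h : nat -> F) (l : 'I_L) :
  (forall i, (i < N)%N -> h i != 0) ->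
  (forall i j, (i < N)%N -> (j < N)%N ->
     \sum_(x < L) p i x * p j x = if i == j then h i else 0) ->
  \sum_(Z : {set 'I_L} | (#|Z| == N) && (l \in Z))
     \det (sample_mx (fun k : 'I_N => p k) Z) ^+ 2 =
  \prod_(k < N) h k * \sum_(k < N) p k l ^+ 2 / h k.
Proof.
move=> h0 orth; pose f (k : 'I_N) := p k.
pose D (Z : {set 'I_L}) := \det (sample_mx f Z) ^+ 2.
have eqA : \det (\matrix_(i, j) \sum_(x < L) 1 * f i x * f j x) =
    \sum_(Z : {set 'I_L} | (#|Z| == N) && (l \in Z)) D Z
    + \sum_(Z : {set 'I_L} | (#|Z| == N) && (l \notin Z)) D Z.
  rewrite (Cauchy_Binet (fun=> 1) f) (bigID (fun Z : {set 'I_L} => l \in Z)) /=.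
  by congr (_ + _); apply: eq_bigr => Z _; rewrite big1 // mul1r.
have eqB : \det (\matrix_(i, j) \sum_(x < L) (x != l)%:R * f i x * f j x) =
    \sum_(Z : {set 'I_L} | (#|Z| == N) && (l \notin Z)) D Z.
  rewrite (Cauchy_Binet (fun x => (x != l)%:R) f) (bigID (fun Z : {set 'I_L} =>
    l \in Z)) /=.
  rewrite big1 ?add0r => [|Z /andP[_ lZ]];
    last by rewrite (bigD1 l) //= eqxx !mul0r.
  apply: eq_bigr => Z /andP[_ lZ]; rewrite big1 ?mul1r // => x xZ.
  by rewrite (contraTneq _ xZ) // => ->.
move: eqA; rewrite -eqB => /esym/(canRL (addrK _)) ->.
pose H : 'rV[F]_N := \row_k h k; pose v : 'rV[F]_N := \row_k p k l.
have -> : \matrix_(i, j) \sum_(x < L) 1 * f i x * f j x = diag_mx H.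
  apply/matrixP=> i j; rewrite !mxE; under eq_bigr do rewrite mul1r.
  by rewrite orth // -val_eqE mulrb.
have -> : \matrix_(i, j) \sum_(x < L) (x != l)%:R * f i x * f j x = diag_mx H -
  v^T *m v.
  apply/matrixP=> i j; rewrite !mxE big_ord1 !mxE mulrb -val_eqE -(orth _ _
    (ltn_ord i) (ltn_ord j)).
  rewrite (bigD1 l) //= [in RHS](bigD1 l) //= eqxx !mul0r add0r addrAC subrr
    add0r.
  by apply: eq_bigr => x ->; rewrite mul1r.
rewrite det_diag_sub_rank1 => [|i]; last by rewrite mxE h0.
rewrite det_diag; under eq_bigr do rewrite mxE.
under [X in _ - _ * (_ - X)]eq_bigr do rewrite !mxE.
by rewrite mulrBr mulr1 opprB addrC subrK.
Qed.

(** * Discrete Chebyshev polynomials *)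

Lemma natr_bin_diag (n k : nat) :
  k.+1%:R * 'C(n.+1, k.+1)%:R = n.+1%:R * 'C(n, k)%:R :> rat.
Proof. by rewrite -!natrM -mul_bin_diag. Qed.

Lemma natr_bin_left (n k : nat) :
  k.+1%:R * 'C(n, k.+1)%:R = (n%:R - k%:R) * 'C(n, k)%:R :> rat.
Proof.
have [kn|nk] := leqP k n; first by rewrite -natrB // -!natrM mul_bin_left.
by rewrite !bin_small ?mulr0 //; lia.
Qed.

Lemma natr_central_bin (n : nat) :
  n.+1%:R * 'C(2 * n.+1, n.+1)%:R = 2 * (2 * n + 1)%:R * 'C(2 * n, n)%:R :> rat.
Proof.
have := natr_bin_diag (2 * n).+1 n; have := natr_bin_left (2 * n).+1 n.
have := natr_bin_diag (2 * n) n.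
by rewrite mulnS !add2n -!natr1 (natrD _ (2 * n) 1) !(natrM _ 2 n) => *; lra.
Qed.

(** The letters [K], [I], [l] stand for [k], [i], [L]; [a] to [g] for binomials near
    ['C(k + i, 2 * i)], which is [g]; [u], [v] for ['C(L.-1, i.+1)], ['C(L.-1, i)]; [w], [z] for the
    central binomials; [e] for the sign. Everything is expressed through [g], [u], [z] and [e]. *)
Lemma gram_coef_rec_algebra (K I l a b c d f g u v w z e : rat) :
  I + 1 != 0 -> 2 * I + 1 != 0 ->
  (2 * I + 1 + 1) * a = (K + I + 1 + 1) * c ->
  (2 * I + 1) * c = (K + I + 1) * g ->
  (2 * I + 1 + 1) * b = (K + I + 1) * f ->
  (2 * I + 1) * f = (K + I - 2 * I) * g ->
  (2 * I + 1 + 1) * d = (K + I - (2 * I + 1)) * f ->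
  (I + 1) * u = (l - 1 - I) * v ->
  (I + 1) * w = 2 * (2 * I + 1) * z -> u != 0 -> v != 0 ->
  (K + 1) * (l - 1 - K) * (-1 * e * w * a / u) =
  (2 * K + 1) * ((l - 1 - 2 * (I + 1)) * (-1 * e * w * b / u)
    - 2 * (I + 1) * (e * z * g / v)) -
  K * (l + K) * (-1 * e * w * d / u).
Proof.
move=> i1 i2 E1 E2 E3 E4 E5 EL Ei u0 v0.
have i3 : 2 * I + 1 + 1 != 0 by rewrite (_ : _ + 1 = 2 * (I + 1)) ?mulf_neq0
  //; ring.
have l0 : l - 1 - I != 0.
  by apply: contra_neq (mulf_neq0 i1 u0) => l0; rewrite EL l0 mul0r.
have Ef : f = (K - I) * g / (2 * I + 1) by apply: (mulfI i2); rewrite E4; field.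
have Ec : c = (K + I + 1) * g / (2 * I + 1) by apply: (mulfI i2); rewrite E2;
  field.
have Ea : a = (K + I + 2) * c / (2 * I + 1 + 1) by apply: (mulfI i3);
  rewrite E1; field.
have Eb : b = (K + I + 1) * f / (2 * I + 1 + 1) by apply: (mulfI i3);
  rewrite E3; field.
have Ed : d = (K - I - 1) * f / (2 * I + 1 + 1) by apply: (mulfI i3);
  rewrite E5; field.
have Ew : w = 2 * (2 * I + 1) * z / (I + 1) by apply: (mulfI i1); rewrite Ei;
  field.
have Ev : v = (I + 1) * u / (l - 1 - I) by apply: (mulfI l0); rewrite -EL;
  field.
by rewrite Ea Eb Ed Ew Ev Ec Ef; field; rewrite ?i1 ?i2 ?i3 ?l0 ?u0.
Qed.

Section GramPolynomials.
Variable L : nat.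

(** With ['C(x, i)] this is the term of index [i] of the series 3F2(-k, k+1, -x; 1, 1-L; 1), since
    (-k)_i (k+1)_i / i!^2 = (-1)^i ['C(2 * i, i) * 'C(k + i, 2 * i)] and (-x)_i / (1-L)_i =
    ['C(x, i) / 'C(L.-1, i)]. *)
Definition gram_coef (k i : nat) : rat :=
  (-1) ^+ i * 'C(2 * i, i)%:R * 'C(k + i, 2 * i)%:R / 'C(L.-1, i)%:R.

(* The discrete Chebyshev (Gram) polynomial of degree k on {0, ..., L - 1},
   normalised to be 1 at 0. *)
Definition gram (k x : nat) : rat :=
  \sum_(i < k.+1) gram_coef k i * 'C(x, i)%:R.

Lemma gram_coef_small k i : (k < i)%N -> gram_coef k i = 0.
Proof. by move=> ki; rewrite /gram_coef (@bin_small (k + i)) ?mulr0 ?mul0r //;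
  lia. Qed.

Lemma gramE k x n : (k < n)%N -> gram k x = \sum_(i < n) gram_coef k i * 'C(x,
  i)%:R.
Proof.
move=> kn; rewrite /gram (big_ord_widen n (fun i =>
  gram_coef k i * 'C(x, i)%:R)) //.
rewrite big_mkcond; apply: eq_bigr => i _; case: ltnP => // ki.
by rewrite gram_coef_small ?mul0r.
Qed.

Lemma bin_pred_neq0 i : (i < L)%N -> 'C(L.-1, i)%:R != 0 :> rat.
Proof. by move=> iL; rewrite pnatr_eq0 -lt0n bin_gt0; lia. Qed.

(** This is the coefficient of ['C(x, i.+1)] in the three-term recurrence; the two terms with
    [gram_coef k] reflect that [x * 'C(x, i) = i * 'C(x, i) + (i + 1) * 'C(x, i.+1)]. For [k = 0]
    the factor [k] disposes of [k.-1]. *)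
Lemma gram_coef_rec k i : (k < L)%N -> (i.+1 < L)%N ->
  (k%:R + 1) * (L%:R - 1 - k%:R) * gram_coef k.+1 i.+1 =
  (2 * k%:R + 1) * ((L%:R - 1 - 2 * (i%:R + 1)) * gram_coef k i.+1
     - 2 * (i%:R + 1) * gram_coef k i)
  - k%:R * (L%:R + k%:R) * gram_coef k.-1 i.+1.
Proof.
move=> kL iL; rewrite /gram_coef.
have i1 : i%:R + 1 != 0 :> rat by rewrite natr1 pnatr_eq0.
have i2 : 2 * i%:R + 1 != 0 :> rat by rewrite -natrM natr1 pnatr_eq0.
have Ei := natr_central_bin i.
have EL := natr_bin_left L.-1 i.
have L0 := bin_pred_neq0 iL; have L1 := bin_pred_neq0 (ltnW iL).
have E1 := natr_bin_diag (k + i).+1 (2 * i).+1.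
have E2 := natr_bin_diag (k + i) (2 * i).
have E3 := natr_bin_diag (k + i) (2 * i).+1.
have E4 := natr_bin_left (k + i) (2 * i).
have E5 := natr_bin_left (k + i) (2 * i).+1.
have -> : 'C(k.+1 + i.+1, 2 * i.+1) = 'C((k + i).+2, (2 * i).+2)
  by congr 'C(_, _); lia.
have -> : 'C(k + i.+1, 2 * i.+1) = 'C((k + i).+1, (2 * i).+2)
  by congr 'C(_, _); lia.
have -> : k%:R * (L%:R + k%:R) * ((-1) ^+ i.+1 * 'C(2 * i.+1, i.+1)%:R
    * 'C(k.-1 + i.+1, 2 * i.+1)%:R / 'C(L.-1, i.+1)%:R) =
  k%:R * (L%:R + k%:R) * ((-1) ^+ i.+1 * 'C(2 * i.+1, i.+1)%:R
    * 'C(k + i, (2 * i).+2)%:R / 'C(L.-1, i.+1)%:R) :> rat.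
  case: (k) => [|k']; first by rewrite !mul0r.
  by rewrite (_ : 'C(_ + i.+1, _) = 'C(k'.+1 + i, (2 * i).+2)) //;
    congr 'C(_, _); lia.
have LE : L.-1%:R = L%:R - 1 :> rat by rewrite -[in RHS](ltn_predK iL) -natr1
  addrK.
move: E1 E2 E3 E4 E5 EL Ei L0 L1; rewrite LE -!natr1 (natrD _ (2 * i) 1)
  !(natrD _ k i) !(natrM _ 2 i) exprS.
move: 'C((k + i).+2, _)%:R 'C((k + i).+1, (2 * i).+2)%:R 'C((k + i).+1, _)%:R
  'C(k + i, (2 * i).+2)%:R 'C(k + i, (2 * i).+1)%:R 'C(k + i, 2 * i)%:R
  'C(L.-1, i.+1)%:R 'C(L.-1, i)%:R 'C(2 * i.+1, i.+1)%:R 'C(2 * i, i)%:R ((-1)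
    ^+ i).
move: k%:R i%:R L%:R i1 i2 => K I l i1 i2 a b c d f g u v w z e.
move=> E1 E2 E3 E4 E5 EL Ei u0 v0.
exact: (gram_coef_rec_algebra e i1 i2 E1 E2 E3 E4 E5 EL Ei u0 v0).
Qed.

Lemma gram_coef0 k : gram_coef k 0 = 1.
Proof. by rewrite /gram_coef muln0 !bin0 invr1 !mulr1. Qed.

Lemma gram0 x : gram 0 x = 1.
Proof. by rewrite /gram big_ord1 gram_coef0 bin0 mulr1. Qed.

Lemma gram_rec k x : (k < L)%N -> (x < L)%N ->
  (k%:R + 1) * (L%:R - 1 - k%:R) * gram k.+1 x =
  (2 * k%:R + 1) * ((L%:R - 1 - 2 * x%:R) * gram k x)
  - k%:R * (L%:R + k%:R) * gram k.-1 x.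
Proof.
move=> kL xL.
have mulX : (L%:R - 1 - 2 * x%:R) * gram k x = (L%:R - 1) + \sum_(i < k.+1)
    ((L%:R - 1 - 2 * (i%:R + 1)) * gram_coef k i.+1
     - 2 * (i%:R + 1) * gram_coef k i) * 'C(x, i.+1)%:R.
  transitivity (\sum_(i < k.+2) (L%:R - 1 - 2 * i%:R) * (gram_coef k i * 'C(x,
    i)%:R)
    - \sum_(i < k.+1) 2 * (i%:R + 1) * gram_coef k i * 'C(x, i.+1)%:R).
    rewrite big_ord_recr /= gram_coef_small // mul0r mulr0 addr0.
    rewrite big_distrr /= -sumrB; apply: eq_bigr => i _.
    have := natr_bin_left x i; rewrite -natr1 => E.
    have -> : 2 * (i%:R + 1) * gram_coef k i * 'C(x, i.+1)%:R =
      2 * gram_coef k i * ((i%:R + 1) * 'C(x, i.+1)%:R) :> rat by ring.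
    by rewrite E; ring.
  rewrite big_ord_recl /= gram_coef0 bin0 !mulr1 mulr0 subr0 -addrA -sumrB.
  by congr (_ + _); apply: eq_bigr => i _; rewrite /bump add1n -natr1; ring.
rewrite mulX !(@gramE _ x k.+2); [|lia..].
rewrite ![\sum_(i < k.+2) _]big_ord_recl /= !gram_coef0 !bin0 !mulr1.
set S1 := \sum_(i < k.+1) gram_coef k.+1 _ * _.
set S2 := \sum_(i < k.+1) _; set S3 := \sum_(i < k.+1) _.
suff E : (k%:R + 1) * (L%:R - 1 - k%:R) * S1 =
    (2 * k%:R + 1) * S2 - k%:R * (L%:R + k%:R) * S3 by rewrite mulrDr E; ring.
rewrite !big_distrr -sumrB; apply: eq_bigr => i _ /=; rewrite /bump add1n.
(* From index [L] on the coefficients divide by a zero binomial and obey no recurrence, but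
   ['C(x, i.+1)] vanishes there because [x < L]. *)
have [iL|Li] := ltnP i.+1 L; last by rewrite bin_small ?mulr0 ?subr0 //; lia.
by rewrite [LHS]mulrA gram_coef_rec //; ring.
Qed.

Definition gram_inner (j k : nat) : rat := \sum_(x < L) gram j x * gram k x.

Lemma gram_innerC j k : gram_inner j k = gram_inner k j.
Proof. by apply: eq_bigr => x _; rewrite mulrC. Qed.

(* Telescoping: -k (k + 1) tau_i = (i + 1) (i + 2) tau_(i+1) - i (i + 1) tau_i. *)
Lemma sum_gram k : (0 < k)%N -> (k < L)%N -> \sum_(x < L) gram k x = 0.
Proof.
move=> k0 kL; rewrite exchange_big /=.
pose tau i : rat := (-1) ^+ i * 'C(2 * i, i)%:R * 'C(k + i, 2 * i)%:R / i.+1%:R.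
transitivity (L%:R * \sum_(i < k.+1) tau i).
  rewrite big_distrr; apply: eq_bigr => i _.
  rewrite -big_distrr /= -(big_mkord xpredT (fun x =>
    'C(x, i)%:R)) sum_binomial // subr0.
  have := natr_bin_diag L.-1 i; rewrite prednK; last by lia.
  have i0 : i.+1%:R != 0 :> rat by rewrite pnatr_eq0.
  have C0 := @bin_pred_neq0 i (leq_ltn_trans (leq_ord i) kL).
  move=> E; have -> : 'C(L, i.+1)%:R = L%:R * 'C(L.-1, i)%:R / i.+1%:R :> rat.
    by rewrite -E mulrC mulKf.
  by move: i0; rewrite /gram_coef /tau; move: (i.+1%:R : rat) => I1 i0; field;
    rewrite ?C0 ?i0.
pose D i : rat := i%:R * (i%:R + 1) * tau i.
have DE i : - (k%:R * (k%:R + 1)) * tau i = D i.+1 - D i.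
  have Ei := natr_central_bin i.
  have E1 := natr_bin_diag (k + i) (2 * i).+1.
  have E2 := natr_bin_left (k + i) (2 * i).
  have i1 : i%:R + 1 != 0 :> rat by rewrite natr1 pnatr_eq0.
  have i2 : 2 * i%:R + 1 != 0 :> rat by rewrite -natrM natr1 pnatr_eq0.
  have i3 : i%:R + 1 + 1 != 0 :> rat by rewrite !natr1 pnatr_eq0.
  have i4 : 2 * i%:R + 1 + 1 != 0 :> rat by rewrite -natrM !natr1 pnatr_eq0.
  rewrite /D /tau (_ : 'C(k + i.+1, 2 * i.+1) = 'C((k + i).+1, (2 * i).+2));
    last first.
    by congr 'C(_, _); lia.
  move: Ei E1 E2; rewrite -!natr1 (natrD _ (2 * i) 1) !(natrD _ k i) !(natrM _
    2 i) exprS.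
  move: 'C(2 * i.+1, i.+1)%:R 'C((k + i).+1, (2 * i).+2)%:R 'C(k + i, (2 *
    i).+1)%:R
    'C(k + i, 2 * i)%:R 'C(2 * i, i)%:R ((-1) ^+ i) i1 i2 i3 i4 => W A f g w e.
  move: (k%:R : rat) (i%:R : rat) => K I i1 i2 i3 i4 Ei E1 E2.
  have -> : W = 2 * (2 * I + 1) * w / (I + 1) by apply: (mulfI i1); rewrite Ei;
    field.
  have -> : A = (K + I + 1) * f / (2 * I + 1 + 1) by apply: (mulfI i4);
    rewrite E1; field.
  have -> : f = (K - I) * g / (2 * I + 1) by apply: (mulfI i2); rewrite E2;
    field.
  by field; rewrite ?i1 ?i2 ?i3 ?i4.
suff: - (k%:R * (k%:R + 1)) * (\sum_(i < k.+1) tau i) = 0.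
  move/eqP; rewrite mulf_eq0 oppr_eq0 mulf_eq0 natr1 !pnatr_eq0 /= orbF.
  by rewrite (gtn_eqF k0) => /eqP->; rewrite mulr0.
rewrite big_distrr /=; under eq_bigr do rewrite DE.
rewrite -(big_mkord xpredT (fun i => D i.+1 - D i)) telescope_sumr //.
rewrite /D /tau (@bin_small (k + _)); last by lia.
by rewrite !(mul0r, mulr0) subr0.
Qed.

(** Multiplication by [L - 1 - 2 x] is self-adjoint; the recurrence expresses it in either
    argument. *)
Lemma gram_inner_shift j k : (j < L)%N -> (k < L)%N ->
  (2 * k%:R + 1) * ((j%:R + 1) * (L%:R - 1 - j%:R) * gram_inner j.+1 k
     + j%:R * (L%:R + j%:R) * gram_inner j.-1 k) =
  (2 * j%:R + 1) * ((k%:R + 1) * (L%:R - 1 - k%:R) * gram_inner j k.+1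
     + k%:R * (L%:R + k%:R) * gram_inner j k.-1).
Proof.
move=> jL kL; have half i l : (i < L)%N -> (i%:R + 1) * (L%:R - 1 - i%:R) *
  gram_inner i.+1 l
     + i%:R * (L%:R + i%:R) * gram_inner i.-1 l =
     (2 * i%:R + 1) * \sum_(x < L) (L%:R - 1 - 2 * x%:R) * gram i x * gram l x.
  move=> iL; rewrite /gram_inner !big_distrr -big_split /=;
    apply: eq_bigr => x _.
  by rewrite !mulrA -mulrDl gram_rec // subrK !mulrA.
rewrite ![gram_inner j _]gram_innerC !half // mulrCA; congr (_ * (_ * _)).
by apply: eq_bigr => x _; ring.
Qed.

(** Induction on the smaller index, starting from [sum_gram]: the shift reduces [j.+1] to products
    whose first index is [j] or [j.-1] and whose second index is still larger. *)
Lemma gram_orthogonal j k : (j < k)%N -> (k < L)%N -> gram_inner j k = 0.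
Proof.
elim/ltn_ind: j k => -[|j] IHj k jk kL.
  by rewrite -(sum_gram jk kL); apply: eq_bigr => x _; rewrite gram0 mul1r.
have := @gram_inner_shift j k (leq_trans (ltnW jk) (ltnW kL)) kL.
have -> : j%:R * (L%:R + j%:R) * gram_inner j.-1 k = 0.
  case: j jk IHj => [|j] jk IHj; first by rewrite !mul0r.
  by rewrite IHj ?mulr0 //; lia.
rewrite [gram_inner j k.-1]IHj //; [|lia..].
(* For [k.+1 = L] the induction hypothesis does not reach degree [L], but the coefficient
   [L - 1 - k] is 0. *)
have -> : (k%:R + 1) * (L%:R - 1 - k%:R) * gram_inner j k.+1 = 0.
  have [kL'|Lk] := ltnP k.+1 L; first by rewrite IHj ?mulr0 //; lia.
  have -> : L = k.+1 by lia.
  by rewrite -natr1 addrK subrr mulr0 mul0r.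
rewrite !(addr0, mulr0) => /eqP; rewrite !mulf_eq0 natr1 -natrM natr1
  !pnatr_eq0 /=.
have -> : L%:R - 1 - j%:R = (L - 1 - j)%:R :> rat by rewrite !natrB //; lia.
by rewrite pnatr_eq0; case: eqP => [|_ /eqP //]; lia.
Qed.

Definition gram_norm (k : nat) : rat :=
  (L + k)`!%:R * (L.-1 - k)`!%:R / ((2 * k%:R + 1) * (L.-1)`!%:R ^+ 2).

(** Between [k] and [k.+1] orthogonality leaves just two terms of the shift, which give the ratio of
    consecutive norms. *)
Lemma gram_inner_diag k : (k < L)%N -> gram_inner k k = gram_norm k.
Proof.
have f0 n : n`!%:R != 0 :> rat by rewrite pnatr_eq0 -lt0n fact_gt0.
elim: k => [|k IHk] kL.
  rewrite /gram_inner; under eq_bigr do rewrite gram0 mulr1.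
  rewrite sumr_const card_ord /gram_norm addn0 subn0 mulr0 add0r mul1r.
  by rewrite -{2}(ltn_predK kL) factS natrM (ltn_predK kL); field.
have := @gram_inner_shift k k.+1 (ltnW kL) kL.
have -> : k%:R * (L%:R + k%:R) * gram_inner k.-1 k.+1 = 0.
  case: k {IHk} kL => [|k] kL; first by rewrite !mul0r.
  by rewrite gram_orthogonal ?mulr0.
have -> : (k.+1%:R + 1) * (L%:R - 1 - k.+1%:R) * gram_inner k k.+2 = 0.
  have [kL'|Lk] := ltnP k.+2 L; first by rewrite gram_orthogonal ?mulr0.
  have -> : L = k.+2 by lia.
  by rewrite -[k.+2%:R]natr1 addrK subrr mulr0 mul0r.
rewrite /= IHk ?(ltnW kL) // addr0 add0r.
rewrite /gram_norm addnS factS natrM -addnS.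
have -> : (L.-1 - k)%N = (L.-1 - k.+1).+1 by lia.
rewrite factS natrM.
have -> : (L.-1 - k.+1).+1%:R = L%:R - 1 - k%:R :> rat.
  rewrite (_ : (L.-1 - k.+1).+1 = L - 1 - k)%N ?natrB //; lia.
have l0 : L%:R - 1 - k%:R != 0 :> rat.
  have -> : L%:R - 1 - k%:R = (L - 1 - k)%:R :> rat by rewrite !natrB //; lia.
  by rewrite pnatr_eq0; lia.
have k1 : k%:R + 1 != 0 :> rat by rewrite natr1 pnatr_eq0.
have k2 : 2 * k%:R + 1 != 0 :> rat by rewrite -natrM natr1 pnatr_eq0.
have k3 : 2 * (k%:R + 1) + 1 != 0 :> rat by rewrite natr1 -natrM natr1
  pnatr_eq0.
rewrite natrD -!natr1 => E.
have -> : gram_inner k.+1 k.+1 = (2 * (k%:R + 1) + 1) * ((k%:R + 1) * (L%:R - 1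
  - k%:R)
  * gram_inner k.+1 k.+1) / ((2 * (k%:R + 1) + 1) * ((k%:R + 1) * (L%:R - 1 -
    k%:R))).
  by field; rewrite k1 k3 l0.
by rewrite E; field; rewrite ?k1 ?k2 ?k3 ?l0 ?f0.
Qed.
End GramPolynomials.

(** * Values at the center *)

Definition cbin (n : nat) : rat := 'C(2 * n, n)%:R.

Lemma cbin0 : cbin 0 = 1. Proof. by []. Qed.

Lemma cbinS n : cbin n.+1 = 2 * (2 * n%:R + 1) / (n%:R + 1) * cbin n.
Proof.
have n1 : n%:R + 1 != 0 :> rat by rewrite natr1 pnatr_eq0.
apply: (mulfI n1); have := natr_central_bin n.
by rewrite -!natr1 (natrD _ (2 * n) 1) natrM -/(cbin n) -/(cbin n.+1) => ->;
  field.
Qed.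

Lemma cbin_neq0 n : cbin n != 0.
Proof. by rewrite pnatr_eq0 -lt0n bin_gt0; lia. Qed.

Section Center.
Variable s : nat.

(** The common factor of the weights of index [2 n] and [2 n + 1] at the center. The constant
    [s / 2] makes the weight of index 0 equal to [1 / (2 s)], the inverse of the norm of 1. *)
Definition center_factor (n : nat) : rat :=
  s%:R / 2 * \prod_(i < n)
    ((s%:R ^+ 2 - (i%:R + 1) ^+ 2) / (4 * (4 * s%:R ^+ 2 - (2 * i%:R + 1) ^+
      2))).

Lemma center_factorS n : center_factor n.+1 =
  (s%:R ^+ 2 - (n%:R + 1) ^+ 2) / (4 * (4 * s%:R ^+ 2 - (2 * n%:R + 1) ^+ 2))
  * center_factor n.
Proof. by rewrite /center_factor big_ord_recr /=; ring. Qed.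

Lemma center_den_neq0 n : 4 * s%:R ^+ 2 - (2 * n%:R + 1) ^+ 2 != 0 :> rat.
Proof.
rewrite subr_eq0 -natrX -natrM -(natrM _ 2 n) natr1 -natrX eqr_nat.
by apply/eqP; lia.
Qed.

Lemma sub_sqr_neq0 k : (k < s)%N -> s%:R ^+ 2 - k%:R ^+ 2 != 0 :> rat.
Proof.
move=> ks; rewrite subr_sqr mulf_neq0 // ?subr_eq0 ?eqr_nat -?natrD ?pnatr_eq0;
  lia.
Qed.

Local Notation q k := (gram (2 * s) k s ^+ 2 / gram_norm (2 * s) k).

Lemma gram_norm_neq0 L k : gram_norm L k != 0.
Proof.
have f0 i : i`!%:R != 0 :> rat by rewrite pnatr_eq0 -lt0n fact_gt0.
have k2 : 2 * k%:R + 1 != 0 :> rat by rewrite -natrM natr1 pnatr_eq0.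
by rewrite /gram_norm !mulf_neq0 ?invr_neq0 ?mulf_neq0 ?expf_neq0.
Qed.

Lemma gram_normS L k : (k.+1 < L)%N ->
  gram_norm L k = gram_norm L k.+1
    * ((2 * k%:R + 3) * (L%:R - 1 - k%:R)) / ((2 * k%:R + 1) * (L%:R + k%:R +
      1)).
Proof.
move=> kL; rewrite /gram_norm addnS factS natrM.
have -> : (L.-1 - k)%N = (L.-1 - k.+1).+1 by lia.
rewrite factS natrM.
have -> : (L.-1 - k.+1).+1%:R = L%:R - 1 - k%:R :> rat.
  rewrite (_ : (L.-1 - k.+1).+1 = L - 1 - k)%N ?natrB //; lia.
have f0 n : n`!%:R != 0 :> rat by rewrite pnatr_eq0 -lt0n fact_gt0.
have l0 : L%:R + k%:R + 1 != 0 :> rat by rewrite -natrD natr1 pnatr_eq0.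
have k2 : 2 * k%:R + 1 != 0 :> rat by rewrite -natrM natr1 pnatr_eq0.
have k3 : 2 * (k%:R + 1) + 1 != 0 :> rat by rewrite natr1 -natrM natr1
  pnatr_eq0.
rewrite -!natr1 natrD; field; rewrite ?f0 ?l0 ?k2 ?k3 //.
Qed.

(** At [x = s] with [L = 2 s] the factor [L - 1 - 2 x] equals -1. *)
Lemma gram_center_rec k : (k < 2 * s)%N ->
  (k%:R + 1) * (2 * s%:R - 1 - k%:R) * gram (2 * s) k.+1 s =
  - (2 * k%:R + 1) * gram (2 * s) k s - k%:R * (2 * s%:R + k%:R) * gram (2 * s)
    k.-1 s.
Proof.
move=> ks; have sL : (s < 2 * s)%N by lia.
by have := gram_rec ks sL; rewrite (natrM _ 2 s) => ->; ring.
Qed.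

(** The two-term relation between degrees [2 j] and [2 j + 1] eliminates the lowest term of the
    recurrence, which after division by [4 (s - 1 - j)] has two terms as well. [gram_center_odd]
    continues in the same way, dividing by [2 j + 3]. *)
Lemma gram_center_even j : (j.+1 < s)%N ->
  (2 * s%:R - 1 - 2 * j%:R) * gram (2 * s) (2 * j).+1 s
    = - (2 * j%:R + 1) * gram (2 * s) (2 * j) s ->
  (j%:R + 1) * gram (2 * s) (2 * j).+2 s
    = (s%:R + j%:R + 1) * gram (2 * s) (2 * j).+1 s.
Proof.
move=> js; have : ((2 * j).+1 < 2 * s)%N by lia.
move=> /gram_center_rec /=; rewrite -!natr1 (natrM _ 2 j).
have : s%:R - 1 - j%:R != 0 :> rat.
  have -> : s%:R - 1 - j%:R = (s - 1 - j)%:R :> rat by rewrite !natrB //; lia.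
  by rewrite pnatr_eq0; lia.
move: (gram _ (2 * j).+2 s) (gram _ (2 * j).+1 s) (gram _ (2 * j) s) =>
  P2 P1 P0.
move: (s%:R : rat) (j%:R : rat) => S J s0 E E1.
apply: (mulfI (mulf_neq0 (isT : 4 != 0 :> rat) s0)).
transitivity ((2 * J + 1 + 1) * (2 * S - 1 - (2 * J + 1)) * P2); first by ring.
transitivity (- (2 * (2 * J + 1) + 1) * P1 + (2 * S + (2 * J + 1)) * (- (2 * J
  + 1) * P0)).
  by rewrite E; ring.
by rewrite -E1; ring.
Qed.

Lemma gram_center_odd j : (j < s)%N ->
  (2 * s%:R - 1 - 2 * j%:R) * gram (2 * s) (2 * j).+1 s
    = - (2 * j%:R + 1) * gram (2 * s) (2 * j) s.
Proof.
elim: j => [|j IHj] js.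
  have : (0 < 2 * s)%N by lia.
  by move=> /gram_center_rec /=; rewrite muln0 => E; move: E;
    rewrite !mulr0 !mul0r; lra.
have := gram_center_even js (IHj (ltnW js)).
have -> : (2 * j.+1)%N = (2 * j).+2 by lia.
have : ((2 * j).+2 < 2 * s)%N by lia.
move=> /gram_center_rec /=; rewrite -!natr1 (natrM _ 2 j).
have : 2 * j%:R + 3 != 0 :> rat by rewrite -natrM -natrD pnatr_eq0; lia.
move: (gram _ (2 * j).+3 s) (gram _ (2 * j).+2 s) (gram _ (2 * j).+1 s) =>
  P3 P2 P1.
move: (s%:R : rat) (j%:R : rat) => S J j0 E E1.
apply: (mulfI j0).
transitivity ((2 * J + 1 + 1 + 1) * (2 * S - 1 - (2 * J + 1 + 1)) * P3);
  first by ring.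
transitivity (- (4 * J + 5) * P2 - 4 * (J + 1) * ((S + J + 1) * P1)).
  by rewrite E; ring.
by rewrite -E1; ring.
Qed.

(** The two-term relations and [gram_normS] give the ratios of consecutive weights, one for each
    parity; the induction alternates between them. *)
Lemma center_weight n : (n < s)%N ->
  q (2 * n) = (4 * n%:R + 1) * cbin n ^+ 2 * center_factor n / s%:R ^+ 2
  /\ q (2 * n).+1 = (4 * n%:R + 3) * (2 * n%:R + 1) ^+ 2 * cbin n ^+ 2 *
    center_factor n
       / (s%:R ^+ 2 * (4 * s%:R ^+ 2 - (2 * n%:R + 1) ^+ 2)).
Proof.
have odd_of_even j : (j < s)%N -> q (2 * j).+1 = q (2 * j) *
    ((2 * j%:R + 1) ^+ 2 * (4 * j%:R + 3)
      / ((4 * j%:R + 1) * (4 * s%:R ^+ 2 - (2 * j%:R + 1) ^+ 2))).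
  move=> js; have E := gram_center_odd js.
  have jL : ((2 * j).+1 < 2 * s)%N by lia.
  rewrite (gram_normS jL) (natrM _ 2 s) (natrM _ 2 j).
  have h0 := gram_norm_neq0 (2 * s) (2 * j).+1.
  have a0 : 2 * s%:R - 1 - 2 * j%:R != 0 :> rat.
    have -> : 2 * s%:R - 1 - 2 * j%:R = (2 * s - 1 - 2 * j)%:R :> rat.
      by rewrite !natrB -?natrM //; lia.
    by rewrite pnatr_eq0; lia.
  have -> : gram (2 * s) (2 * j).+1 s = - (2 * j%:R + 1) * gram (2 * s) (2 * j)
    s
      / (2 * s%:R - 1 - 2 * j%:R) by rewrite -E mulrC mulKf.
  have b0 : 2 * s%:R + 2 * j%:R + 1 != 0 :> rat
    by rewrite -!natrM -natrD natr1 pnatr_eq0.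
  have c0 : 4 * j%:R + 1 != 0 :> rat by rewrite -!natrM natr1 pnatr_eq0.
  have d0 : 2 * (2 * j%:R) + 3 != 0 :> rat by rewrite -!natrM -natrD pnatr_eq0;
    lia.
  have := center_den_neq0 j.
  move: (gram_norm _ _) h0 (gram _ _ _) => h h0 P.
  move: (s%:R : rat) (j%:R : rat) a0 b0 c0 d0 {E} => S J a0 b0 c0 d0 e0.
  by field; rewrite ?a0 ?b0 ?c0 ?d0 ?h0 ?e0.
have even_of_odd j : (j.+1 < s)%N -> q (2 * j).+2 = q (2 * j).+1 *
    ((s%:R ^+ 2 - (j%:R + 1) ^+ 2) * (4 * j%:R + 5)
      / ((j%:R + 1) ^+ 2 * (4 * j%:R + 3))).
  move=> js; have E := gram_center_even js (gram_center_odd (ltnW js)).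
  have jL : ((2 * j).+2 < 2 * s)%N by lia.
  rewrite (gram_normS jL) (natrM _ 2 s) -!natr1 (natrM _ 2 j).
  have h0 := gram_norm_neq0 (2 * s) (2 * j).+2.
  have a0 : j%:R + 1 != 0 :> rat by rewrite natr1 pnatr_eq0.
  have b0 : s%:R - 1 - j%:R != 0 :> rat.
    have -> : s%:R - 1 - j%:R = (s - 1 - j)%:R :> rat by rewrite !natrB //; lia.
    by rewrite pnatr_eq0; lia.
  have -> : gram (2 * s) (2 * j).+2 s = (s%:R + j%:R + 1) * gram (2 * s) (2 *
    j).+1 s
      / (j%:R + 1) by rewrite -E mulrC mulKf.
  have c0 : s%:R + j%:R + 1 != 0 :> rat by rewrite -!natrD natr1 pnatr_eq0.
  have d0 : 4 * j%:R + 3 != 0 :> rat by rewrite -!natrM -natrD pnatr_eq0; lia.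
  have e0 : 4 * j%:R + 5 != 0 :> rat by rewrite -!natrM -natrD pnatr_eq0; lia.
  move: (gram_norm _ _) h0 (gram _ _ _) => h h0 P.
  move: (s%:R : rat) (j%:R : rat) a0 b0 c0 d0 e0 {E} => S J a0 b0 c0 d0 e0.
  have b1 : 2 * S - 1 - (2 * J + 1) != 0.
    by rewrite (_ : _ - _ = 2 * (S - 1 - J)) ?mulf_neq0 //; ring.
  have c1 : 2 * S + (2 * J + 1) + 1 != 0.
    by rewrite (_ : _ + 1 = 2 * (S + J + 1)) ?mulf_neq0 //; ring.
  have e1 : 2 * (2 * J + 1) + 3 != 0 by rewrite (_ : _ + 3 = 4 * J + 5) //;
    ring.
  by field; rewrite ?a0 ?b1 ?c1 ?d0 ?e1 ?h0.
have fromeven j : (j < s)%N ->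
    q (2 * j) = (4 * j%:R + 1) * cbin j ^+ 2 * center_factor j / s%:R ^+ 2 ->
    q (2 * j).+1 = (4 * j%:R + 3) * (2 * j%:R + 1) ^+ 2 * cbin j ^+ 2 *
      center_factor j
       / (s%:R ^+ 2 * (4 * s%:R ^+ 2 - (2 * j%:R + 1) ^+ 2)).
  move=> js E; rewrite odd_of_even // E.
  have s0 : s%:R != 0 :> rat by rewrite pnatr_eq0; lia.
  have c0 : 4 * j%:R + 1 != 0 :> rat by rewrite -!natrM natr1 pnatr_eq0.
  have := center_den_neq0 j.
  move: (s%:R : rat) (j%:R : rat) s0 c0 {E} => S J s0 c0 e0.
  by field; rewrite ?s0 ?c0 ?e0.
have s0 : (0 < s)%N -> s%:R != 0 :> rat by rewrite pnatr_eq0; case: (s).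
elim: n => [|n IHn] ns.
  suff E : q (2 * 0) = (4 * 0%:R + 1) * cbin 0 ^+ 2 * center_factor 0 / s%:R ^+
    2.
    by split; [|apply: fromeven].
  have f0 i : i`!%:R != 0 :> rat by rewrite pnatr_eq0 -lt0n fact_gt0.
  rewrite muln0 gram0 /gram_norm addn0 subn0 cbin0 /center_factor big_ord0.
  have L0 : (0 < 2 * s)%N by lia.
  rewrite -{1}(prednK L0) factS natrM (prednK L0) (natrM _ 2 s).
  move: (f0 (2 * s).-1) (s0 ns); move: (_`!%:R) (s%:R : rat) => f S f1 S0.
  by field; rewrite ?f1 ?S0.
have [_ E] := IHn (ltnW ns).
suff E' : q (2 * n.+1) =
    (4 * n.+1%:R + 1) * cbin n.+1 ^+ 2 * center_factor n.+1 / s%:R ^+ 2.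
  by split; [|apply: fromeven].
have -> : (2 * n.+1)%N = (2 * n).+2 by lia.
rewrite even_of_odd // E cbinS center_factorS -[n.+1%:R]natr1.
have a0 : n%:R + 1 != 0 :> rat by rewrite natr1 pnatr_eq0.
have d0 : 4 * n%:R + 3 != 0 :> rat by rewrite -!natrM -natrD pnatr_eq0; lia.
have := center_den_neq0 n; have := s0 (leq_ltn_trans (leq0n _) ns).
move: (center_factor n) (cbin n) => c b.
move: (s%:R : rat) (n%:R : rat) a0 d0 {E} => S J a0 d0 S0 e0.
by field; rewrite ?a0 ?d0 ?S0 ?e0.
Qed.

(** The remainder, free of [s], in the induction step of [sum_center_weight]. Four times the summand
    is a difference of neighbouring products [cbin (n + k) * cbin (n.+1 - k)]. *)
Lemma center_telescope n : 4 * (\sum_(k < n) (k%:R + 1) * cbin (n + k.+1) *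
  cbin (n - k.+1)
    / ((n%:R + 1) ^+ 2 - (k%:R + 1) ^+ 2)) = cbin (2 * n).+1 - cbin n.+1 * cbin
      n.
Proof.
pose v k := cbin (n + k) * cbin (n.+1 - k).
transitivity (\sum_(0 <= k < n) (v k.+2 - v k.+1)).
  rewrite big_distrr big_mkord; apply: eq_bigr => k _ /=.
  rewrite /v (_ : n + k.+2 = (n + k.+1).+1)%N; last by lia.
  rewrite (_ : n.+1 - k.+1 = (n - k.+1).+1)%N; last by have := ltn_ord k; lia.
  rewrite (_ : n.+1 - k.+2 = n - k.+1)%N; last by lia.
  rewrite !cbinS; have -> : n%:R = k%:R + 1 + (n - k.+1)%:R :> rat.
    by rewrite natr1 -natrD; congr (_%:R); have := ltn_ord k; lia.
  have -> : (n + k.+1)%:R = (k%:R + 1) + (k%:R + 1) + (n - k.+1)%:R :> rat.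
    by rewrite natr1 -!natrD; congr (_%:R); have := ltn_ord k; lia.
  move: (cbin _) (cbin _) => b c.
  have h1 : (n - k.+1)%:R + 1 != 0 :> rat by rewrite natr1 pnatr_eq0.
  have h2 : (k%:R + 1) + (k%:R + 1) + (n - k.+1)%:R + 1 != 0 :> rat.
    by rewrite natr1 -!natrD natr1 pnatr_eq0.
  move: (k%:R : rat) ((n - k.+1)%:R : rat) h1 h2 => K R h1 h2.
  have h3 : (K + 1 + R + 1) ^+ 2 - (K + 1) ^+ 2 != 0.
    rewrite (_ : _ - _ = (R + 1) * (K + 1 + (K + 1) + R + 1)) ?mulf_neq0 //;
      ring.
  by field; rewrite ?h1 ?h2 ?h3.
have [->|n0] := posnP n; first by rewrite big_geq // muln0 !cbinS cbin0; field.
rewrite (telescope_sumr (fun k => v k.+1)) // /v subn1 subnn cbin0 mulr1 addn1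
  /=.
by congr (cbin _ - _); lia.
Qed.

(** Up to [center_factor] and [(2 n + 1) * cbin n ^+ 2], the right-hand side is the parenthesis of
    the theorem, with the hypergeometric terms rewritten by central binomials as in [summandE]. *)
Lemma sum_center_weight n : (n < s)%N ->
  \sum_(k < (2 * n).+1) q k = center_factor n *
    ((2 * n%:R + 1) * cbin n ^+ 2 / s%:R ^+ 2
     + 4 * \sum_(k < n) (k%:R + 1) * cbin (n + k.+1) * cbin (n - k.+1)
         / (s%:R ^+ 2 - (k%:R + 1) ^+ 2)).
Proof.
elim: n => [|n IHn] ns.
  have [E _] := center_weight ns; rewrite big_ord1 big_ord0 mulr0 addr0.
  by rewrite -[nat_of_ord ord0]/(2 * 0)%N E; ring.
have -> : (2 * n.+1).+1 = (2 * n).+3 by lia.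
rewrite 2!big_ord_recr /= IHn ?(ltnW ns) //.
have [_ ->] := center_weight (ltnW ns); have [] := center_weight ns.
have -> : (2 * n.+1)%N = (2 * n).+2 by lia.
move=> -> _.
pose S m := \sum_(k < m) (k%:R + 1) * cbin (m + k.+1) * cbin (m - k.+1)
         / (s%:R ^+ 2 - (k%:R + 1) ^+ 2).
rewrite -/(S n) -/(S n.+1).
have s0 : s%:R != 0 :> rat by rewrite pnatr_eq0; lia.
have a0 : n%:R + 1 != 0 :> rat by rewrite natr1 pnatr_eq0.
have e0 := center_den_neq0 n.
have d0 : s%:R ^+ 2 - (n%:R + 1) ^+ 2 != 0 :> rat by rewrite natr1 sub_sqr_neq0.
(* With these multipliers the terms of index [k < n] in [S n.+1] and [S n] have equal residues at
   [s ^ 2 = (k + 1) ^ 2]. Their differences are constants in [s], summed by [center_telescope]; in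
   the extra term [k = n] the multiplier cancels the denominator. *)
have ES : (s%:R ^+ 2 - (n%:R + 1) ^+ 2) * S n.+1 =
    4 * (4 * s%:R ^+ 2 - (2 * n%:R + 1) ^+ 2) * S n
    + (4 * n%:R + 3) * cbin n * cbin n.+1.
  rewrite /S big_ord_recr /= mulrDr.
  have -> : (s%:R ^+ 2 - (n%:R + 1) ^+ 2) * ((n%:R + 1) * cbin (n.+1 + n.+1)
      * cbin (n.+1 - n.+1) / (s%:R ^+ 2 - (n%:R + 1) ^+ 2)) =
      (4 * n%:R + 3) * cbin (2 * n).+1.
    rewrite subnn cbin0 (_ : n.+1 + n.+1 = (2 * n).+2)%N; last by lia.
    rewrite cbinS -[(2 * n).+1%:R]natr1 (natrM _ 2 n); move: (cbin _) => b.
    have b0 : 2 * n%:R + 1 + 1 != 0 :> rat by rewrite -natrM !natr1 pnatr_eq0.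
    by move: (s%:R : rat) (n%:R : rat) b0 d0 {a0 e0 s0} => X J b0 d0; field;
      rewrite ?b0 ?d0.
  have -> : (4 * n%:R + 3) * cbin (2 * n).+1 = (4 * n%:R + 3) * cbin n * cbin
    n.+1
      + (4 * n%:R + 3) * (4 * (\sum_(k < n) (k%:R + 1) * cbin (n + k.+1) * cbin
        (n - k.+1)
    / ((n%:R + 1) ^+ 2 - (k%:R + 1) ^+ 2))) by rewrite center_telescope; ring.
  rewrite addrCA addrC; congr (_ + _); rewrite !big_distrr -big_split;
    apply: eq_bigr => k _ /=.
  rewrite (_ : n.+1 + k.+1 = (n + k.+1).+1)%N; last by lia.
  rewrite (_ : n.+1 - k.+1 = (n - k.+1).+1)%N; last by have := ltn_ord k; lia.
  have kd : s%:R ^+ 2 - (k%:R + 1) ^+ 2 != 0 :> rat.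
    by rewrite natr1 sub_sqr_neq0 //; have := ltn_ord k; lia.
  rewrite !cbinS; move: d0 e0; have -> : n%:R = k%:R + 1 + (n - k.+1)%:R :> rat.
    by rewrite natr1 -natrD; congr (_%:R); have := ltn_ord k; lia.
  have -> : (n + k.+1)%:R = (k%:R + 1) + (k%:R + 1) + (n - k.+1)%:R :> rat.
    by rewrite natr1 -!natrD; congr (_%:R); have := ltn_ord k; lia.
  move: (cbin _) (cbin _) => b c.
  have h1 : (n - k.+1)%:R + 1 != 0 :> rat by rewrite natr1 pnatr_eq0.
  have h2 : (k%:R + 1) + (k%:R + 1) + (n - k.+1)%:R + 1 != 0 :> rat.
    by rewrite natr1 -!natrD natr1 pnatr_eq0.
  move: (s%:R : rat) (k%:R : rat) ((n - k.+1)%:R : rat) kd h1 h2 =>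
    X K R kd h1 h2 d0 e0.
  have h3 : (K + 1 + R + 1) ^+ 2 - (K + 1) ^+ 2 != 0.
    rewrite (_ : _ - _ = (R + 1) * (K + 1 + (K + 1) + R + 1)) ?mulf_neq0 //;
      ring.
  by field; rewrite ?h1 ?h2 ?h3 ?kd.
have -> : S n.+1 = (4 * (4 * s%:R ^+ 2 - (2 * n%:R + 1) ^+ 2) * S n
    + (4 * n%:R + 3) * cbin n * cbin n.+1) / (s%:R ^+ 2 - (n%:R + 1) ^+ 2).
  by rewrite -ES mulrC mulKf.
rewrite cbinS center_factorS -[n.+1%:R]natr1.
move: (S n) (center_factor n) (cbin n) => T c b.
move: (s%:R : rat) (n%:R : rat) a0 s0 d0 e0 {ES} => X J a0 s0 d0 e0.
by field; rewrite ?a0 ?s0 ?d0 ?e0.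
Qed.
End Center.

(** * The closed formula *)

(** Induction with [n + m] fixed: lowering [n] by one raises [m] by one. *)
Lemma center_factor_bin n m :
  center_factor (n + m) n = m%:R * cbin m / (2 * cbin (2 * n + m)).
Proof.
elim: n m => [|n IHn] m.
  rewrite /center_factor big_ord0 muln0 !add0n mulr1; have := cbin_neq0 m.
  by move: (cbin m) (m%:R : rat) => b x b0; field.
rewrite addSnnS center_factorS IHn.
have -> : (2 * n + m.+1 = (2 * n + m).+1)%N by lia.
have -> : (2 * n.+1 + m = (2 * n + m).+2)%N by lia.
rewrite !cbinS -[(2 * n + m).+1%:R]natr1 (natrD _ n) (natrD _ (2 * n)) (natrM _
  2 n) -[m.+1%:R]natr1.
have := cbin_neq0 (2 * n + m); move: (cbin _) (cbin _) => b c b0.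
have h1 : m%:R + 1 != 0 :> rat by rewrite natr1 pnatr_eq0.
have h2 : 2 * m%:R + 1 != 0 :> rat by rewrite -natrM natr1 pnatr_eq0.
have h3 : 2 * n%:R + m%:R + 1 != 0 :> rat
  by rewrite -natrM -natrD natr1 pnatr_eq0.
have h4 : 2 * n%:R + m%:R + 1 + 1 != 0 :> rat
  by rewrite -natrM -natrD !natr1 pnatr_eq0.
have h5 : 2 * (2 * n%:R + m%:R) + 1 != 0 :> rat.
  by rewrite -(natrM _ 2 n) -natrD -(natrM _ 2) natr1 pnatr_eq0.
have h6 : 2 * (2 * n%:R + m%:R + 1) + 1 != 0 :> rat.
  by rewrite -(natrM _ 2 n) -natrD natr1 -(natrM _ 2) natr1 pnatr_eq0.
move: (n%:R : rat) (m%:R : rat) h1 h2 h3 h4 h5 h6 => x y h1 h2 h3 h4 h5 h6.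
have h7 : 4 * (x + (y + 1)) ^+ 2 - (2 * x + 1) ^+ 2 != 0.
  rewrite (_ : _ - _ = (2 * y + 1) * (2 * (2 * x + y + 1) + 1)) ?mulf_neq0 //;
    ring.
by field; rewrite ?b0 ?h1 ?h2 ?h3 ?h4 ?h5 ?h6 ?h7.
Qed.

Lemma prefactorE n m : (0 < m)%N ->
  (n%:R + 1) * m%:R * 'C(2 * n, n)%:R * 'C(2 * n + 1, n)%:R * 'C(2 * m - 1,
    m)%:R
    / 'C(4 * n + 2 * m, 2 * n + m)%:R
  = center_factor (n + m) n * ((2 * n%:R + 1) * cbin n ^+ 2) :> rat.
Proof.
move=> m0; rewrite center_factor_bin.
have -> : 'C(4 * n + 2 * m, 2 * n + m)%:R = cbin (2 * n + m).
  by rewrite /cbin; congr ('C(_, _)%:R); lia.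
have E1 : (n%:R + 1) * 'C(2 * n + 1, n)%:R = (2 * n%:R + 1) * cbin n :> rat.
  have := natr_bin_diag (2 * n) n; rewrite -!natr1 (natrM _ 2 n) -/(cbin n) =>
    <-.
  congr (_ * _%:R); rewrite -[in RHS]bin_sub; last by lia.
  by congr 'C(_, _); lia.
have E2 : 2 * 'C(2 * m - 1, m)%:R = cbin m :> rat.
  rewrite /cbin -(prednK m0); set k := m.-1.
  have := natr_bin_diag (2 * k).+1 k; have := natr_bin_left (2 * k).+1 k.
  have -> : (2 * k.+1 - 1 = (2 * k).+1)%N by lia.
  have -> : (2 * k.+1 = (2 * k).+2)%N by lia.
  have k1 : k%:R + 1 != 0 :> rat by rewrite natr1 pnatr_eq0.
  rewrite -!natr1 (natrM _ 2 k) => E E'; apply: (mulfI k1);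
    rewrite E' mulrCA E; ring.
have := cbin_neq0 (2 * n + m); rewrite -E2; move: (cbin (2 * n + m)) => c c0.
move: E1; rewrite -/(cbin n); move: (cbin n) ('C(2 * n + 1, n)%:R : rat) ('C(2
  * m - 1, m)%:R : rat) => b d f.
move: (n%:R : rat) (m%:R : rat) => x y E1.
have -> : (x + 1) * y * b * d * f / c = ((x + 1) * d) * (y * b * f / c) by ring.
by rewrite E1; field.
Qed.

Lemma shifted_factorialS a k :
  shifted_factorial a k.+1 = shifted_factorial a k * (a + k%:R).
Proof. by rewrite /shifted_factorial big_nat_recr. Qed.

Lemma shifted_factorial0 a : shifted_factorial a 0 = 1.
Proof. by rewrite /shifted_factorial big_geq. Qed.

(** The quotient of (2)_h by (1)_h is [h + 1]; the factors with [n + m] collapse to the denominator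
    [(n + m) ^ 2 - (h + 1) ^ 2]; the others have the term ratios of
    [cbin (n + h.+1) * cbin (n - h.+1)]. The hypotheses keep all denominators away from 0. *)
Lemma summandE n m h : (0 < m)%N -> (h < n)%N ->
  let nq : rat := n%:R in let mq : rat := m%:R in
  4 * nq / ((nq + 1) * (2 * nq - 1) * (nq + mq - 1) * (nq + mq + 1)) *
  ((shifted_factorial 2 h * shifted_factorial (1 - nq) h
    * shifted_factorial (3 / 2 + nq) h * shifted_factorial (1 - nq - mq) h
    * shifted_factorial (1 + nq + mq) h)
   / (shifted_factorial 1 h * shifted_factorial (2 + nq) h
      * shifted_factorial (3 / 2 - nq) h * shifted_factorial (2 + nq + mq) h
      * shifted_factorial (2 - nq - mq) h)) =
  4 / (2 * nq + 1) * ((h%:R + 1) * cbin (n + h.+1) * cbin (n - h.+1) / cbin n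
    ^+ 2
     / ((n + m)%:R ^+ 2 - (h%:R + 1) ^+ 2)).
Proof.
case: m => // k _; elim: h => [|h IHh] hn nq mq.
  move: hn @nq; case: n => // r _ /=.
  rewrite !shifted_factorial0 addn1 subn1 !cbinS /mq.
  have c0 := cbin_neq0 r; rewrite (natrD _ r.+1) -[k.+1%:R]natr1
    -[r.+1%:R]natr1.
  have h1 : r%:R + 1 != 0 :> rat by rewrite natr1 pnatr_eq0.
  have h2 : r%:R + 1 + 1 != 0 :> rat by rewrite !natr1 pnatr_eq0.
  have h3 : 2 * r%:R + 1 != 0 :> rat by rewrite -natrM natr1 pnatr_eq0.
  have h4 : 2 * (r%:R + 1) + 1 != 0 :> rat
    by rewrite natr1 -natrM natr1 pnatr_eq0.
  have h5 : r%:R + k%:R + 1 != 0 :> rat by rewrite -natrD natr1 pnatr_eq0.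
  have h6 : r%:R + k%:R + 1 + 1 + 1 != 0 :> rat
    by rewrite -natrD !natr1 pnatr_eq0.
  move: (cbin r) (r%:R : rat) (k%:R : rat) c0 h1 h2 h3 h4 h5 h6 =>
    c x y c0 h1 h2 h3 h4 h5 h6.
  have h7 : (x + 1 + (y + 1)) ^+ 2 - (0 + 1) ^+ 2 != 0.
    rewrite (_ : _ - _ = (x + y + 1) * (x + y + 1 + 1 + 1)) ?mulf_neq0 //; ring.
  have h8 : 2 * (x + 1) - 1 != 0 by rewrite (_ : _ - 1 = 2 * x + 1) //; ring.
  have h9 : x + 1 + (y + 1) - 1 != 0 by rewrite (_ : _ - 1 = x + y + 1) //;
    ring.
  have h10 : x + 1 + (y + 1) + 1 != 0 by rewrite (_ : _ + 1 = x + y + 1 + 1 +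
    1) //; ring.
  by field; rewrite ?h1 ?h2 ?h3 ?h4 ?h5 ?h6 ?h7 ?h8 ?h9 ?h10 ?c0.
have := IHh (ltnW hn); rewrite -/nq -/mq !shifted_factorialS.
have [r nE] : exists r, n = (h + r).+2 by exists (n - h.+2)%N; lia.
rewrite (_ : n + h.+2 = (n + h.+1).+1)%N; last by lia.
rewrite (_ : n - h.+1 = r.+1)%N; last by lia.
rewrite (_ : n - h.+2 = r)%N; last by lia.
rewrite !cbinS => E; set C := _ / _.
pose x : rat := h%:R; pose y : rat := r%:R; pose z : rat := k%:R.
have nqE : nq = x + y + 2 by rewrite /nq nE -!natr1 natrD -addrA.
have mqE : mq = z + 1 by rewrite /mq -natr1.
transitivity (4 / (2 * nq + 1) * ((x + 1) * cbin (n + h.+1) * (2 * (2 * y + 1)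
  / (y + 1) * cbin r)
    / cbin n ^+ 2 / ((n + k.+1)%:R ^+ 2 - (x + 1) ^+ 2))
  * ((2 + x) * (1 - nq + x) * (3 / 2 + nq + x) * (1 - nq - mq + x) * (1 + nq +
    mq + x)
    / ((1 + x) * (2 + nq + x) * (3 / 2 - nq + x) * (2 + nq + mq + x) * (2 - nq
      - mq + x)))).
  by rewrite -E /C /x !invfM; ring.
rewrite -[h.+1%:R]natr1 -/x !natrD -/nq -/mq -[h.+1%:R]natr1 -/x.
have -> : 3 / 2 - nq + x = - (2 * y + 1) / 2 by rewrite nqE; field.
have -> : 3 / 2 + nq + x = (2 * (nq + (x + 1)) + 1) / 2 by field.
have -> : 2 - nq - mq + x = - (y + z + 1) by rewrite nqE mqE; ring.
have -> : 1 - nq - mq + x = - (y + z + 2) by rewrite nqE mqE; ring.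
have -> : 1 - nq + x = - (y + 1) by rewrite nqE; ring.
have -> : 2 + nq + x = nq + (x + 1) + 1 by ring.
have -> : (nq + mq) ^+ 2 - (x + 1) ^+ 2 = (y + z + 2) * (1 + nq + mq + x).
  by rewrite nqE mqE; ring.
have -> : (nq + mq) ^+ 2 - (x + 1 + 1) ^+ 2 = (y + z + 1) * (2 + nq + mq + x).
  by rewrite nqE mqE; ring.
have x0 : 0 <= x by exact: ler0n.
have y0 : 0 <= y by exact: ler0n.
have z0 : 0 <= z by exact: ler0n.
have h1 : y + 1 != 0 by apply: lt0r_neq0; lra.
have h2 : 2 * y + 1 != 0 by apply: lt0r_neq0; lra.
have h3 : 1 + x != 0 by apply: lt0r_neq0; lra.
have h4 : nq + (x + 1) + 1 != 0 by apply: lt0r_neq0; lra.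
have h5 : y + z + 1 != 0 by apply: lt0r_neq0; lra.
have h6 : y + z + 2 != 0 by apply: lt0r_neq0; lra.
have h7 : 1 + nq + mq + x != 0 by apply: lt0r_neq0; lra.
have h8 : 2 + nq + mq + x != 0 by apply: lt0r_neq0; lra.
have h9 : 2 * nq + 1 != 0 by apply: lt0r_neq0; lra.
have := cbin_neq0 n.
move: (cbin n) (cbin r) (cbin (n + h.+1)) nq mq x y z h1 h2 h3 h4 h5 h6 h7 h8
  h9 {C E nqE mqE x0 y0 z0}.
move=> c d f nq mq x y z h1 h2 h3 h4 h5 h6 h7 h8 h9 c0.
by field; rewrite ?h1 ?h2 ?h3 ?h4 ?h5 ?h6 ?h7 ?h8 ?h9 ?c0.
Qed.

(** * The triple product and the norms *)

Lemma prodr_telescope (F : fieldType) (f : nat -> F) n :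
  (forall i, (i <= n)%N -> f i != 0) ->
  \prod_(i < n) (f i.+1 / f i) = f n / f 0%N.
Proof.
elim: n => [|n IHn] f0; first by rewrite big_ord0 divff ?f0.
rewrite big_ord_recr /= IHn => [|i ni]; last by rewrite f0 ?(leqW ni).
by rewrite mulrC mulrA divfK ?f0.
Qed.

(** Both sides are the product of the factorials of all numbers below [2 N], grouped by halves or by
    parity. *)
Lemma prod_fact_doubling N :
  (\prod_(k < N) (k`! * (k + N)`!) = \prod_(k < N) ((2 * k)`! * (2 *
    k).+1`!))%N.
Proof.
transitivity (\prod_(k < N + N) k`!)%N.
  rewrite big_split_ord big_split /=; congr (_ * _)%N.
  by apply: eq_bigr => k _; rewrite addnC.
elim: N => [|N IHN]; first by rewrite !big_ord0.
rewrite [RHS]big_ord_recr /= -IHN addSn addnS !big_ord_recr /= -mulnA.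
by congr (_ * (_`! * _`!))%N; lia.
Qed.

(** The right-hand side is the Gram determinant of the binomials ['C(x, k)], [k < N]. On the left
    the products over [k] and then [j] telescope to factorials; those of [2 k] and [2 k + 1], which
    the norms and leading coefficients bring in, are matched by [prod_fact_doubling]. *)
Lemma plane_partition_product N M : (0 < M)%N ->
  \prod_(1 <= i < N.+1) \prod_(1 <= j < M.+1) \prod_(1 <= k < N.+1)
     ((i%:R + j%:R + k%:R - 1) / (i%:R + j%:R + k%:R - 2)) =
  \prod_(k < N) (gram_norm (N + M) k / gram_coef (N + M) k k ^+ 2) :> rat.
Proof.
move=> M0; have f0 i : i`!%:R != 0 :> rat by rewrite pnatr_eq0 -lt0n fact_gt0.
transitivity (\prod_(k < N) ((k + N + M)`!%:R * k`!%:R / ((k + N)`!%:R * (k +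
  M)`!%:R)) : rat).
  rewrite big_add1 /= big_mkord; apply: eq_bigr => i _.
  transitivity (\prod_(j < M) ((i + j.+1 + N)%:R / (i + j.+1)%:R) : rat).
    rewrite big_add1 /= big_mkord; apply: eq_bigr => j _.
    rewrite big_add1 /= big_mkord.
    have := @prodr_telescope rat (fun k => (i + j.+1 + k)%:R) N.
    rewrite /= addn0 => <-; last by move=> k _; rewrite pnatr_eq0; lia.
    apply: eq_bigr => k _; rewrite !natrD -!natr1; congr (_ / _); ring.
  have := @prodr_telescope rat (fun j => (i + j + N)`!%:R / (i + j)`!%:R) M.
  rewrite addn0 => E.
  transitivity (((i + M + N)`!%:R / (i + M)`!%:R) / ((i + N)`!%:R / i`!%:R) :
    rat).
    rewrite -E; last by move=> j _; rewrite mulf_neq0 ?invr_neq0.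
    apply: eq_bigr => j _; rewrite !addnS addSn !factS !natrM.
    have := f0 (i + j + N)%N; have := f0 (i + j)%N.
    have : (i + j).+1%:R != 0 :> rat by rewrite pnatr_eq0.
    move: (_`!%:R) (_`!%:R) ((i + j).+1%:R : rat) ((i + j + N).+1%:R : rat) =>
      a b c d c0 a0 b0.
    by field; rewrite ?a0 ?b0 ?c0.
  rewrite addnAC; have := f0 i; have := f0 (i + N)%N; have := f0 (i + M)%N.
  move: (i`!%:R : rat) ((i + N)`!%:R : rat) ((i + M)`!%:R : rat) ((i + N +
    M)`!%:R : rat) => a b c d c0 b0 a0.
  by field; rewrite ?a0 ?b0 ?c0.
transitivity (\prod_(k < N) (((k + N + M)`!%:R * k`!%:R * k`!%:R)
    / ((N + M - k.+1)`!%:R * ((2 * k)`! * (2 * k).+1`!)%:R)) : rat); last first.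
  apply: eq_bigr => k _; rewrite /gram_norm /gram_coef.
  have -> : 'C(k + k, 2 * k)%:R = 1 :> rat by rewrite addnn -mul2n binn.
  have kL : (k <= (N + M).-1)%N by have := ltn_ord k; lia.
  have EC : 'C((N + M).-1, k)%:R = (N + M).-1`!%:R / (k`!%:R * ((N + M).-1 -
    k)`!%:R) :> rat.
    by rewrite -(bin_fact kL) !natrM mulfK ?mulf_neq0.
  have ED : 'C(2 * k, k)%:R = (2 * k)`!%:R / (k`!%:R * k`!%:R) :> rat.
    have k2 : (k <= 2 * k)%N by lia.
    rewrite -(bin_fact k2) (_ : 2 * k - k = k)%N; last by lia.
    by rewrite !natrM mulfK ?mulf_neq0.
  rewrite EC ED factS !natrM -natr1 (natrM _ 2 k) !exprMn sqrr_sign -addnA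
    addnC.
  rewrite (_ : (N + M - k.+1) = ((N + M).-1 - k))%N; last by lia.
  have h0 : 2 * k%:R + 1 != 0 :> rat by rewrite -natrM natr1 pnatr_eq0.
  have := f0 k; have := f0 ((N + M).-1 - k)%N; have := f0 (2 * k)%N;
    have := f0 (N + M).-1.
  move: (k`!%:R : rat) ((N + M).-1`!%:R : rat) ((2 * k)`!%:R : rat)
    (((N + M).-1 - k)`!%:R : rat) ((N + M + k)`!%:R : rat) (k%:R : rat) h0 =>
      a b c d e x h0 b0 c0 d0 a0.
  by field; rewrite ?a0 ?b0 ?c0 ?d0 ?h0.
rewrite !prodf_div !big_split /=.
have -> : \prod_(k < N) (N + M - k.+1)`!%:R = \prod_(k < N) (k + M)`!%:R :> rat.
  rewrite (reindex_inj rev_ord_inj) /=; apply: eq_bigr => k _.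
  by congr (_`!%:R); have := ltn_ord k; lia.
have -> : \prod_(k < N) ((2 * k)`! * (2 * k).+1`!)%:R =
    \prod_(k < N) k`!%:R * \prod_(k < N) (k + N)`!%:R :> rat.
  rewrite -natr_prod -prod_fact_doubling natr_prod -big_split /=.
  by apply: eq_bigr => k _; rewrite natrM.
have p0 (g : nat -> nat) : \prod_(k < N) (g k)`!%:R != 0 :> rat
  by apply/prodf_neq0.
have := p0 id; have := p0 (addn^~ N); have := p0 (addn^~ M); rewrite /=.
move: (\prod_(k < N) k`!%:R : rat) (\prod_(k < N) (k + N)`!%:R : rat)
  (\prod_(k < N) (k + M)`!%:R : rat) (\prod_(k < N) _ : rat) =>
    b c d a d0 c0 b0.
by field; rewrite ?b0 ?c0 ?d0.
Qed.

(** * From tilings to the closed formula *)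

(** The change of basis is triangular, with the leading coefficients on its diagonal. *)
Lemma det_sample_gram L N (Z : {set 'I_L}) :
  \det (sample_mx (fun k : 'I_N => gram L k) Z) =
    \prod_(k < N) gram_coef L k k * \det (binomial_mx N [seq val x | x <- enum
      Z]).
Proof.
pose U : 'M[rat]_N := \matrix_(i, j) gram_coef L i j.
have -> : sample_mx (fun k : 'I_N => gram L k) Z =
    binomial_mx N [seq val x | x <- enum Z] *m U^T.
  apply/matrixP=> i j; rewrite !mxE (gramE _ _ (ltn_ord j));
    apply: eq_bigr => k _.
  by rewrite !mxE mulrC.
rewrite det_mulmx det_tr mulrC; congr (_ * _).
rewrite det_trig; first by apply: eq_bigr => i _; rewrite mxE.
by apply/is_trig_mxP=> i j ij; rewrite mxE gram_coef_small.
Qed.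

Lemma sorted_val_enum L (Z : {set 'I_L}) : sorted ltn [seq val x | x <- enum Z].
Proof.
apply: (subseq_sorted ltn_trans _ (iota_ltn_sorted 0 L)).
by rewrite -val_enum_ord map_subseq // {1}/enum_mem -enumT filter_subseq.
Qed.

Lemma card_tilings_axis_rhombus_gram N M l : (0 < N)%N -> (0 < M)%N -> (l < N +
  M)%N ->
  #|[set T in rhombus_tilings N M | axis_rhombus N M l \in T]|%:R =
  \prod_(k < N) (gram_norm (N + M) k / gram_coef (N + M) k k ^+ 2)
  * \sum_(k < N) gram (N + M) k l ^+ 2 / gram_norm (N + M) k :> rat.
Proof.
move=> N0 M0 lK; rewrite card_tilings_axis_rhombus // natr_sum.
pose o := Ordinal lK.
have kL (k : 'I_N) : (k < N + M)%N by have := ltn_ord k; lia.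
have c0 (k : 'I_N) : gram_coef (N + M) k k != 0.
  rewrite /gram_coef addnn -mul2n binn mulr1 !mulf_neq0 ?signr_eq0 ?cbin_neq0
    //.
  by rewrite invr_neq0 // bin_pred_neq0.
have C0 : \prod_(k < N) gram_coef (N + M) k k != 0 by apply/prodf_neq0.
transitivity ((\prod_(k < N) gram_coef (N + M) k k) ^- 2 *
    \sum_(Z : {set 'I_(N + M)} | (#|Z| == N) && (o \in Z))
     \det (sample_mx (fun k : 'I_N => gram (N + M) k) Z) ^+ 2).
  (* By [tilings_left_part], only the sets [Z] with [N] elements contribute. *)
  rewrite big_distrr /= (bigID (fun Z : {set 'I_(N + M)} =>
    #|Z| == N)) /= [X in _ + X]big1 ?addr0.
    apply: eq_big => Z.
      rewrite andbC; congr (_ && _); apply/exists_inP/idP=> [[i iZ /eqP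
        il]|oZ]; last by exists o.
      by rewrite (_ : o = i) //; apply: val_inj.
    case/andP=> _ ZN; rewrite natrX -[in left_part _ 0](subnn N)
      tilings_left_part //.
    - rewrite size_map -cardE ZN det_sample_gram exprMn mulrA mulVf ?mul1r //.
      by rewrite expf_neq0.
    - by rewrite (gtn_eqF N0).
    - exact: sorted_val_enum.
    by apply/allP=> x /mapP[i _ ->]; have := ltn_ord i; lia.
  move=> Z /andP[_ ZN]; rewrite natrX -[in left_part _ 0](subnn N)
    tilings_left_part //.
  - by rewrite size_map -cardE (negbTE ZN) expr0n.
  - by rewrite (gtn_eqF N0).
  - exact: sorted_val_enum.
  by apply/allP=> x /mapP[i _ ->]; have := ltn_ord i; lia.
rewrite (@sum_containing_det rat (N + M) N (gram (N + M)) (gram_norm (N + M))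
  o); first last.
- move=> i j iN jN; rewrite -[LHS]/(gram_inner (N + M) i j).
  have [<-|] := eqVneq i j; first by apply: gram_inner_diag; lia.
  rewrite neq_ltn => /orP[ij|ji]; first by apply: gram_orthogonal; lia.
  by rewrite gram_innerC; apply: gram_orthogonal; lia.
- by move=> i _; apply: gram_norm_neq0.
rewrite mulrA [_ ^- 2 * _]mulrC [in RHS]prodf_div. congr (_ * _ * _);
  congr (_^-1).
by rewrite expr2 -big_split; apply: eq_bigr => k _; rewrite expr2.
Qed.

Theorem theorem2 (n m : nat) (hm : (0 < m)%N) :
  let nq : rat := n%:R in
  let mq : rat := m%:R in
  #|[set T in rhombus_tilings (2 * n + 1) (2 * m - 1)
       | axis_rhombus (2 * n + 1) (2 * m - 1) (n + m) \in T]|%:R =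
  (nq + 1) * mq * 'C(2 * n, n)%:R * 'C(2 * n + 1, n)%:R * 'C(2 * m - 1, m)%:R
    / 'C(4 * n + 2 * m, 2 * n + m)%:R
  * (1 / (nq + mq) ^+ 2
     + 4 * nq / ((nq + 1) * (2 * nq - 1) * (nq + mq - 1) * (nq + mq + 1))
       * \sum_(0 <= h < n)
           (shifted_factorial 2 h * shifted_factorial (1 - nq) h
            * shifted_factorial (3 / 2 + nq) h
            * shifted_factorial (1 - nq - mq) h
            * shifted_factorial (1 + nq + mq) h)
           / (shifted_factorial 1 h * shifted_factorial (2 + nq) h
              * shifted_factorial (3 / 2 - nq) h
              * shifted_factorial (2 + nq + mq) h
              * shifted_factorial (2 - nq - mq) h))
  * \prod_(1 <= i < (2 * n + 1).+1)
      \prod_(1 <= j < (2 * m - 1).+1)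
        \prod_(1 <= k < (2 * n + 1).+1)
          ((i%:R + j%:R + k%:R - 1) / (i%:R + j%:R + k%:R - 2)) :> rat.
Proof.
move=> nq mq; rewrite {}/nq {}/mq; have [N0 M0] : (0 < 2 * n + 1)%N /\ (0 < 2 *
  m - 1)%N by lia.
rewrite plane_partition_product // mulrC card_tilings_axis_rhombus_gram //;
  last by lia.
congr (_ * _); rewrite (_ : 2 * n + 1 + (2 * m - 1) = 2 * (n + m))%N;
  last by lia.
rewrite prefactorE // addn1 sum_center_weight; last by lia.
(* The factor [4 n / ...] is moved into the sum. For [n = 0] the sum is empty, so a denominator
   [n + m - 1 = 0] does no harm. *)
rewrite -[RHS]mulrA; congr (_ * _); rewrite big_mkord !big_distrr /= mulrDr.
have c0 := cbin_neq0 n.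
have n0 : 2 * n%:R + 1 != 0 :> rat by rewrite -natrM natr1 pnatr_eq0.
congr (_ + _); first by rewrite mul1r natrD.
rewrite big_distrr; apply: eq_bigr => h _ /=.
have /= -> := summandE hm (ltn_ord h).
move: (cbin n) (n%:R : rat) c0 n0 ((n + m)%:R ^+ 2 - _ : rat) => c x c0 x0 d.
by move: (d^-1) => e; field; rewrite ?c0 ?x0.
Qed.
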